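(* Let $F$ be a finite field with $q$ elements and characteristic $p$, let $d\ge1$ and let $A\in M_d(F[t])$, acting on $\mathbb{T}_F^d$ by multiplication. Put $r(A)=\prod_{\lambda}\max\{1,|\lambda|\}$, where $\lambda$ ranges over the $d$ eigenvalues of $A$ (with multiplicity). Among these $d$ eigenvalues, let $\mu_1,\ldots,\mu_M$ be all those that are roots of unity and let $\eta_1,\dots,\eta_N$ be all those that have absolute value $1$ and are not roots of unity ($M$ or $N$ may be $0$). For $1\le i\le M$ let $m_i$ be the order of $\mu_i$ modulo $\mathfrak p$, and for $1\le j\le N$ let $n_j$ be the order of $\eta_j$ modulo $\mathfrak p$. Then $N_k(A)<\infty$ for all $k\ge1$, and: (a) If for every $j\in\{1,\dots,N\}$ there exists $i\in\{1,\dots,M\}$ with $m_i\mid n_j$, then $\zeta_A(z)$ is algebraic and $$\zeta_A(z)=(1-r(A)z)^{-1}\prod_{1\le \ell\le M}\ \prod_{1\le i_1<\dots<i_\ell\le M}\left(1-(r(A)z)^{L}\right)^{(-1)^{\ell+1}/L},\quad L=\mathrm{lcm}(m_{i_1},\dots,m_{i_\ell}).$$ (b) Otherwise, i.e. if there exists $j\in\{1,\dots,N\}$ such that $m_i\nmid n_j$ for every $i\in\{1,\dots,M\}$, then the series $\sum_{k\ge1}N_k(A)z^k$ converges in the open disk $\{z\in\mathbb{C}:|z|<1/r(A)\}$ and is not D-finite; consequently $\zeta_A(z)$ is transcendental.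
   Context: $\mathbb{Z}_F=F[t]$, $\mathbb{R}_F=F((1/t))$ with valuation $v(\sum_{i\le m}a_it^i)=-m$ ($a_m\ne0$) and absolute value $|x|=q^{-v(x)}$, extended uniquely to a fixed algebraic closure of $\mathbb{R}_F$. $\mathbb{T}_F=\mathbb{R}_F/\mathbb{Z}_F$ with the quotient topology (a compact abelian group); $A$ acts on $\mathbb{T}_F^d$ via multiplication on $\mathbb{R}_F^d$. For a map $f:X\to X$ of a topological space, $N_k(f)$ is the number of isolated fixed points of $f^k$, and when all are finite the Artin–Mazur zeta function is $\zeta_f(z)=\exp\big(\sum_{k\ge1}\frac{N_k(f)}{k}z^k\big)$. Order modulo $\mathfrak p$: let $\alpha$ be algebraic over $\mathbb{R}_F$ with $|\alpha|=1$, and let $K$ be a finite extension of $\mathbb{R}_F$ containing $\alpha$, with valuation ring $\mathcal O_K=\{|x|\le1\}$, maximal ideal $\mathfrak p_K=\{|x|<1\}$, and residue field of order $q^\delta$. The roots of $X^{q^\delta-1}-1$ in $K$ together with $0$ form a subfield $\cong \mathrm{GF}(q^\delta)$, and $\alpha$ is uniquely written $\alpha=\alpha_{(0)}+\alpha_{(1)}$ with $\alpha_{(0)}\in\mathrm{GF}(q^\delta)$, $\alpha_{(1)}\in\mathfrak p_K$. The order of $\alpha$ modulo $\mathfrak p$ is the multiplicative order of $\alpha_{(0)}$ in $\mathrm{GF}(q^\delta)^*$; equivalently the smallest $n\ge1$ with $|\alpha^n-1|<1$. A series $f\in\mathbb{C}((z))$ is D-finite if its formal derivatives span a finite-dimensional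 $\mathbb{C}(z)$-vector space, equivalently it satisfies a nontrivial linear differential equation with polynomial coefficients. *)

(* Defs.v *)
From HB Require Import structures.
From mathcomp Require Import all_boot all_order all_algebra all_field.
From mathcomp Require Import all_classical all_reals all_analysis.
From mathcomp Require Import finmap complex.
Set Implicit Arguments.
Unset Strict Implicit.
Unset Printing Implicit Defensive.
Import Order.TTheory GRing.Theory Num.Theory.
Import numFieldNormedType.Exports.
Local Open Scope classical_set_scope.
Local Open Scope ring_scope.

(* [laurent K] is the field K((X)).  It is used twice: C((z)) is
   [laurent C] with X = z, and F((1/t)) is [laurent F] with X = 1/t. *)
Record laurent (K : fieldType) := Laurent {
  lcoef :> int -> K;
  lcoefP : exists m : int, forall n : int, n < m -> lcoef n = 0
}.

HB.instance Definition _ (K : fieldType) := gen_eqMixin (laurent K).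
HB.instance Definition _ (K : fieldType) := gen_choiceMixin (laurent K).

Section LaurentField.
Variable K : fieldType.
Implicit Types f g h : laurent K.

Lemma laurentP f g : (forall n, f n = g n) -> f = g.
Proof.
case: f g => f Hf [g Hg] /= fg; have {}fg : f = g by apply/funext.
by subst g; congr Laurent; exact: Prop_irrelevance.
Qed.

Lemma lzero_subproof : exists m : int, forall n, n < m -> 0 = 0 :> K.
Proof. by exists 0. Qed.
Definition lzero := Laurent lzero_subproof.

Lemma lopp_subproof f : exists m, forall n, n < m -> - f n = 0.
Proof. by have [m fm] := lcoefP f; exists m => n /fm ->; rewrite oppr0. Qed.
Definition lopp f := Laurent (lopp_subproof f).

Lemma ladd_subproof f g : exists m, forall n, n < m -> f n + g n = 0.
Proof.
have [m fm] := lcoefP f; have [m' gm] := lcoefP g; exists (Num.min m m') => n.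
by rewrite lt_min => /andP[/fm -> /gm ->]; rewrite addr0.
Qed.
Definition ladd f g := Laurent (ladd_subproof f g).

Lemma laddA : associative ladd.
Proof. by move=> f g h; apply: laurentP => n /=; rewrite addrA. Qed.
Lemma laddC : commutative ladd.
Proof. by move=> f g; apply: laurentP => n /=; rewrite addrC. Qed.
Lemma ladd0 : left_id lzero ladd.
Proof. by move=> f; apply: laurentP => n /=; rewrite add0r. Qed.
Lemma laddN : left_inverse lzero lopp ladd.
Proof. by move=> f; apply: laurentP => n /=; rewrite addNr. Qed.

HB.instance Definition _ := GRing.isZmodule.Build (laurent K)
  laddA laddC ladd0 laddN.

Lemma lcoef0 n : (0 : laurent K) n = 0. Proof. by []. Qed.
Lemma lcoefD f g n : (f + g) n = f n + g n. Proof. by []. Qed.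
Lemma lcoefN f n : (- f) n = - f n. Proof. by []. Qed.

Lemma lcoef_sum I (r : seq I) (P : pred I) (F : I -> laurent K) n :
  (\sum_(i <- r | P i) F i) n = \sum_(i <- r | P i) F i n.
Proof. by elim/big_rec2: _ => // i x y _ <-. Qed.

(* The sum is finitely supported. *)
Definition lmul_coef f g (n : int) : K :=
  \sum_(i \in [set: int]) f i * g (n - i).

Definition vanishes_below f (m : int) := forall n : int, n < m -> f n = 0.

Lemma lmul_coef_lt f g m m' n : vanishes_below f m -> vanishes_below g m' -> n < m + m' ->
  lmul_coef f g n = 0.
Proof.
move=> fm gm nm; apply: fsbig1 => i _.
have [im|mi] := ltP i m; first by rewrite fm ?mul0r.
by rewrite gm ?mulr0 // ltrBlDl (lt_le_trans nm) // lerD2r.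
Qed.

Lemma lmul_coefE f g m m' (N : nat) : vanishes_below f m -> vanishes_below g m' ->
  lmul_coef f g (m + m' + N%:Z) =
  \sum_(j < N.+1) f (m + j%:Z) * g (m' + (N - j)%N%:Z).
Proof.
move=> fm gm; rewrite /lmul_coef; pose r := [seq m + (j : nat)%:Z | j <- iota 0 N.+1].
have r_uniq : uniq r by rewrite map_inj_uniq ?iota_uniq // => a b /addrI [].
have r0 i : [set: int] i -> i \notin r -> f i * g (m + m' + N%:Z - i) = 0.
  move=> _ iN; have [im|mi] := ltP i m; first by rewrite fm ?mul0r.
  have [k ek] : exists k : nat, i = m + k%:Z.
    by exists `|i - m|%N; rewrite gez0_abs ?subr_ge0 // [m + _]addrC subrK.
  have Nk : (N < k)%N.
    rewrite ltnNge; apply/negP => kN; move/negP: iN; apply; rewrite ek.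
    by apply: (map_f (fun j : nat => m + j%:Z)); rewrite mem_iota leq0n add0n ltnS.
  rewrite gm ?mulr0 // ek opprD addrACA [m + m' - m]addrAC subrr add0r.
  by rewrite gtrDl subr_lt0.
rewrite (fsbigE r) //.
rewrite big_map (eq_bigl xpredT); last by move=> j /=; rewrite in_setT.
rewrite -[iota 0 N.+1]/(index_iota 0 N.+1) big_mkord.
apply: eq_bigr => j _; congr (_ * g _).
rewrite -subzn; last by rewrite -ltnS.
by rewrite opprD addrACA [m + m' - m]addrAC subrr add0r addrA.
Qed.

Lemma lmul_subproof f g : exists m, forall n, n < m -> lmul_coef f g n = 0.
Proof.
have [m fm] := lcoefP f; have [m' gm] := lcoefP g; exists (m + m') => n.
exact: lmul_coef_lt.
Qed.
Definition lmul f g := Laurent (lmul_subproof f g).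

Lemma lone_subproof : exists m, forall n : int, n < m -> (n == 0)%:R = 0 :> K.
Proof. by exists 0 => n; rewrite lt_neqAle => /andP[/negPf ->]. Qed.
Definition lone := Laurent lone_subproof.

Let trunc f m N := \poly_(j < N.+1) f (m + j%:Z).

Let lmul_trunc f g m m' N k : vanishes_below f m -> vanishes_below g m' -> (k <= N)%N ->
  lmul f g (m + m' + k%:Z) = (trunc f m N * trunc g m' N)`_k.
Proof.
move=> fm gm kN; rewrite /= (lmul_coefE k fm gm) coefM; apply: eq_bigr => j _.
have jk : (j <= k)%N by rewrite -ltnS.
by rewrite !coef_poly !ltnS (leq_trans jk kN) (leq_trans (leq_subr _ _) kN).
Qed.

Let vanishes_split (m n : int) : n < m \/ exists k : nat, n = m + k%:Z.
Proof.
have [nm|mn] := ltP n m; [by left|right].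
by exists `|n - m|%N; rewrite gez0_abs ?subr_ge0 // [m + _]addrC subrK.
Qed.

Lemma lmulC : commutative lmul.
Proof.
move=> f g; have [m fm] := lcoefP f; have [m' gm] := lcoefP g.
apply: laurentP => n; have [nm|[k ->]] := vanishes_split (m + m') n.
  by rewrite /= (lmul_coef_lt fm gm) // (lmul_coef_lt gm fm) // addrC.
by rewrite (lmul_trunc fm gm (leqnn k)) mulrC -(lmul_trunc gm fm (leqnn k))
  [m' + m]addrC.
Qed.

Lemma lmulA : associative lmul.
Proof.
move=> f g h; have [a fa] := lcoefP f; have [b gb] := lcoefP g.
have [c hc] := lcoefP h.
have fgab : vanishes_below (lmul f g) (a + b) by move=> n; apply: lmul_coef_lt.
have ghbc : vanishes_below (lmul g h) (b + c) by move=> n; apply: lmul_coef_lt.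
apply: laurentP => n; have [nm|[k ->]] := vanishes_split (a + b + c) n.
  rewrite [RHS](lmul_coef_lt fgab hc) // [LHS](lmul_coef_lt fa ghbc) //.
  by rewrite addrA.
rewrite [RHS](lmul_trunc fgab hc (leqnn k)) -[a + b + c]addrA.
rewrite [LHS](lmul_trunc fa ghbc (leqnn k)).
transitivity (trunc f a k * (trunc g b k * trunc h c k))`_k.
  rewrite !(coefM (trunc f a k)); apply: eq_bigr => j _; congr (_ * _).
  rewrite coef_poly ltnS leq_subr; apply: lmul_trunc => //; exact: leq_subr.
rewrite mulrA !(coefM _ (trunc h c k)); apply: eq_bigr => j _; congr (_ * _).
have jk : (j <= k)%N by rewrite -ltnS.
by rewrite coef_poly ltnS jk; apply/esym/lmul_trunc.
Qed.

Lemma lmul1 : left_id lone lmul.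
Proof.
move=> f; apply: laurentP => n /=; rewrite /lmul_coef.
rewrite (fsbigE [:: 0]) // => [|i _]; last first.
  by rewrite inE /= => /negPf ->; rewrite mul0r.
by rewrite big_cons in_setT big_nil /= mul1r subr0 addr0.
Qed.

Lemma lmulDl : left_distributive lmul +%R.
Proof.
move=> f g h; have [a fa] := lcoefP f; have [b gb] := lcoefP g.
have [c hc] := lcoefP h; pose m := Num.min a b.
have fm : vanishes_below f m by move=> n /lt_le_trans nm; apply/fa/nm; rewrite ge_min lexx.
have gm : vanishes_below g m.
  by move=> n /lt_le_trans nm; apply/gb/nm; rewrite ge_min lexx orbT.
have fgm : vanishes_below (f + g) m by move=> n nm; rewrite lcoefD fm // gm // addr0.
apply: laurentP => n; rewrite lcoefD; have [nm|[k ->]] := vanishes_split (m + c) n.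
  by rewrite /= (lmul_coef_lt fm hc) // (lmul_coef_lt gm hc) //
    (lmul_coef_lt fgm hc) // addr0.
rewrite /= (lmul_coefE k fm hc) (lmul_coefE k gm hc) (lmul_coefE k fgm hc).
by rewrite -big_split; apply: eq_bigr => j _; rewrite /= mulrDl.
Qed.

Lemma lone_neq0 : lone != 0.
Proof.
apply/eqP => /(congr1 (fun f : laurent K => f 0)) /= /eqP.
by rewrite oner_eq0.
Qed.

HB.instance Definition _ := GRing.Zmodule_isComNzRing.Build (laurent K)
  lmulA lmulC lmul1 lmulDl lone_neq0.

Lemma lcoefM f g n : (f * g) n = \sum_(i \in [set: int]) f i * g (n - i).
Proof. by []. Qed.

(* The X-adic valuation of f is n. *)
Definition has_val f (n : int) := f n <> 0 /\ forall i : int, i < n -> f i = 0.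

Lemma has_val_ex f : f != 0 -> exists n, has_val f n.
Proof.
move=> f0; have [m fm] := lcoefP f.
have fk : exists k : nat, f (m + k%:Z) != 0.
  apply: contrapT => /forallNP fk; move/eqP: f0; apply.
  apply: laurentP => n; have [/fm//|[k ->]] := vanishes_split m n.
  by apply: contrapT => /eqP; exact: fk.
case: (ex_minnP fk) => k kf kmin; exists (m + k%:Z); split; first exact/eqP.
move=> i; have [/fm//|[l ->]] := vanishes_split m i.
rewrite ltrD2l ltz_nat => lk; apply: contrapT => /eqP /kmin.
by rewrite leqNgt lk.
Qed.

Lemma has_val_uniq f m n : has_val f m -> has_val f n -> m = n.
Proof.
move=> [fm mf] [fn nf]; apply: le_anti; rewrite !leNgt.
by apply/andP; split; apply/negP => h; [apply: fn (mf _ h)|apply: fm (nf _ h)].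
Qed.

(* The valuation is only meaningful on nonzero series. *)
Definition lval f : int := xget 0 (has_val f).

Lemma lvalP f : f != 0 -> has_val f (lval f).
Proof. by move=> /has_val_ex; exact: xgetPex. Qed.

Fixpoint inv_seq (a : nat -> K) (n : nat) : seq K :=
  if n is k.+1 then
    rcons (inv_seq a k)
      (((k == 0)%:R - \sum_(j < k) a (k - j)%N * (inv_seq a k)`_j) / a 0)
  else [::].

Lemma linv_ex f : f != 0 -> exists g, g * f = 1.
Proof.
move=> /has_val_ex[m [fm0 fm]]; pose a (j : nat) := f (m + j%:Z).
have a0 : a 0%N != 0 by rewrite /a addr0; apply/eqP.
pose b n := (inv_seq a n.+1)`_n.
have size_inv n : size (inv_seq a n) = n by elim: n => //= n IH; rewrite size_rcons IH.
have nth_inv n j : (j < n)%N -> (inv_seq a n)`_j = b j.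
  elim: n => // n IH; rewrite ltnS leq_eqVlt => /orP[/eqP -> //|jn].
  by rewrite /= nth_rcons size_inv jn IH.
have ab n : \sum_(j < n.+1) b j * a (n - j)%N = (n == 0%N)%:R.
  rewrite big_ord_recr /= subnn.
  rewrite {2}/b /= nth_rcons size_inv ltnn eqxx divfK //.
  rewrite (eq_bigr (fun j : 'I_n => a (n - j)%N * (inv_seq a n)`_j)).
    by rewrite addrC subrK.
  by move=> j _; rewrite nth_inv // mulrC.
have gP : exists k : int, forall n : int, n < k ->
    (if (- m <= n)%R then b (absz (n + m)) else 0) = 0.
  by exists (- m) => n; rewrite ltNge => /negPf ->.
exists (Laurent gP).
have gm : vanishes_below (Laurent gP) (- m) by move=> n /=; rewrite ltNge => /negPf ->.
apply: laurentP => n; have [nm|[k ->]] := vanishes_split (- m + m) n.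
  rewrite [LHS](lmul_coef_lt gm fm) //= lt_eqF //.
  by rewrite addNr in nm.
rewrite [LHS](lmul_coefE k gm fm) /= addNr add0r eqz_nat -ab.
apply: eq_bigr => j _ /=; congr (_ * _).
by rewrite lerDl le0z_nat addrAC addNr add0r.
Qed.

Definition linv f : laurent K := xget 0 [set g | g * f = 1].

Lemma lmulV f : f != 0 -> linv f * f = 1.
Proof. by move=> /linv_ex; exact: xgetPex. Qed.

Lemma linv0 : linv 0 = 0.
Proof.
rewrite /linv; case: xgetP => // g _ /= /eqP.
by rewrite mulr0 eq_sym oner_eq0.
Qed.

HB.instance Definition _ := GRing.ComNzRing_isField.Build (laurent K)
  lmulV linv0.

End LaurentField.

Section LaurentPoly.
Variable K : fieldType.

Lemma lmono_subproof (c : K) (m : int) :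
  exists k : int, forall n : int, n < k -> (if n == m then c else 0) = 0.
Proof. by exists m => n nm; rewrite lt_eqF. Qed.
Definition lmono c m := Laurent (lmono_subproof c m).

Lemma lcoef_monoM c m (f : laurent K) n : (lmono c m * f) n = c * f (n - m).
Proof.
rewrite lcoefM (fsbigE [:: m]) // => [|i _]; last first.
  by rewrite inE /= => /negPf ->; rewrite mul0r.
by rewrite big_cons in_setT big_nil /= eqxx addr0.
Qed.

Lemma lmonoM c m c' m' : lmono c m * lmono c' m' = lmono (c * c') (m + m').
Proof.
apply: laurentP => n; rewrite lcoef_monoM /= subr_eq [m' + m]addrC.
by case: ifP => _ //; rewrite mulr0.
Qed.

Lemma lmono1 : lmono 1 0 = 1.
Proof. by apply: laurentP => n /=; case: eqP. Qed.

Definition lconst c := lmono c 0.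

Lemma lconst_is_zmod_morphism : zmod_morphism lconst.
Proof.
move=> a b; apply: laurentP => n; rewrite lcoefD lcoefN /=.
by case: ifP => _ //; rewrite subr0.
Qed.
Lemma lconst_is_monoid_morphism : monoid_morphism lconst.
Proof. by split=> [|a b]; rewrite /lconst ?lmono1 // lmonoM addr0. Qed.
HB.instance Definition _ := GRing.isZmodMorphism.Build K (laurent K) lconst
  lconst_is_zmod_morphism.
HB.instance Definition _ := GRing.isMonoidMorphism.Build K (laurent K) lconst
  lconst_is_monoid_morphism.

Definition lX := lmono 1 1.

Lemma lX_exp n : lX ^+ n = lmono 1 n%:Z.
Proof.
elim: n => [|n IH]; first by rewrite expr0 lmono1.
by rewrite exprS IH lmonoM mulr1.
Qed.

Lemma lXV : lX^-1 = lmono 1 (-1).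
Proof.
have XV : lX * lmono 1 (-1) = 1 by rewrite lmonoM mulr1 subrr lmono1.
have X0 : lX != 0.
  by apply: contra_eqN XV => /eqP ->; rewrite mul0r eq_sym oner_eq0.
by apply: (mulfI X0); rewrite XV divff.
Qed.

Lemma lXV_exp n : lX^-1 ^+ n = lmono 1 (- n%:Z).
Proof.
elim: n => [|n IH]; first by rewrite expr0 lmono1.
by rewrite exprS IH lXV lmonoM mulr1 -opprD.
Qed.

Let lconst_comm (x : laurent K) : commr_rmorph lconst x.
Proof. by move=> c; apply: mulrC. Qed.

Definition poly_at (x : laurent K) (p : {poly K}) : laurent K :=
  (map_poly lconst p).[x].

HB.instance Definition _ x := GRing.RMorphism.copy (poly_at x)
  (horner_morph (lconst_comm x)).

Lemma coef_poly_X p n :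
  poly_at lX p n = if n is Posz k then p`_k else 0.
Proof.
rewrite /poly_at horner_poly.
under eq_bigr do rewrite lX_exp lmonoM mulr1 add0r.
rewrite lcoef_sum /=; case: n => [k|k]; last by rewrite big1.
have [kp|pk] := ltnP k (size p).
  rewrite (bigD1 (Ordinal kp)) //= eqxx big1 ?addr0 // => i ik.
  by rewrite eqz_nat eq_sym (negPf (ik : i != k :> nat)).
rewrite nth_default // big1 // => i _; rewrite eqz_nat gtn_eqF //.
exact: leq_trans (ltn_ord i) pk.
Qed.

Lemma coef_poly_XV p n :
  poly_at lX^-1 p n = if n <= 0 then p`_`|n|%N else 0.
Proof.
rewrite /poly_at horner_poly.
under eq_bigr do rewrite lXV_exp lmonoM mulr1 add0r.
rewrite lcoef_sum /=; case: ifP => n0; last first.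
  rewrite big1 // => i _; case: eqP => // ni.
  by rewrite ni oppr_le0 in n0.
have [kp|pk] := ltnP `|n|%N (size p).
  rewrite (bigD1 (Ordinal kp)) //= lez0_abs // opprK eqxx big1 ?addr0 // => i ii.
  case: eqP => // ni; case/eqP: ii; apply: val_inj.
  by rewrite /= ni abszN absz_nat.
rewrite nth_default // big1 // => i _; case: eqP => // ni.
by have := ltn_ord i; rewrite ltnNge (leq_trans pk) // ni abszN absz_nat.
Qed.

Lemma poly_X_inj : injective (poly_at lX).
Proof.
move=> p r pr; apply/polyP => i.
by have := congr1 (fun f : laurent K => f i) pr; rewrite !coef_poly_X.
Qed.

Local Open Scope quotient_scope.
(* The inclusion of K(X) in K((X)), through an arbitrary representative of the
   fraction; it is a ring morphism by the instances below. *)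
Definition laurent_of_frac (x : {fraction {poly K}}) : laurent K :=
  poly_at lX (frac (repr x)).1 / poly_at lX (frac (repr x)).2.

Let dnz (x : {ratio {poly K}}) : poly_at lX (frac x).2 != 0.
Proof. by rewrite -(rmorph0 (poly_at lX)) (inj_eq poly_X_inj) denom_ratioP. Qed.

Let laurent_of_frac_pi (x : {ratio {poly K}}) :
  laurent_of_frac (\pi x) = poly_at lX (frac x).1 / poly_at lX (frac x).2.
Proof.
apply/eqP; rewrite eqr_div // -!rmorphM /= FracField.equivf_l.
by rewrite mulrC.
Qed.

Let laurent_of_fracK x :
  exists2 r : {ratio {poly K}}, x = \pi r & laurent_of_frac x =
    poly_at lX (frac r).1 / poly_at lX (frac r).2.
Proof. by exists (repr x); rewrite ?reprK. Qed.

Lemma laurent_of_frac_is_zmod_morphism : zmod_morphism laurent_of_frac.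
Proof.
move=> x y; have [r -> ->] := laurent_of_fracK x.
have [s -> ->] := laurent_of_fracK y.
rewrite -[X in _ + X]FracField.pi_opp -[_ + _]FracField.pi_add.
rewrite laurent_of_frac_pi /FracField.addf /FracField.oppf.
rewrite !numden_Ratio ?mulf_neq0 ?denom_ratioP //.
by rewrite rmorphD !rmorphM rmorphN -[in RHS]mulNr addf_div.
Qed.

Lemma laurent_of_frac_is_monoid_morphism : monoid_morphism laurent_of_frac.
Proof.
split=> [|x y].
  have -> : 1 = \pi_({fraction {poly K}}) (Ratio 1 1) :> {fraction {poly K}}.
    by rewrite -tofrac1; unlock FracField.tofrac.
  by rewrite laurent_of_frac_pi !numden_Ratio ?oner_neq0 // rmorph1 divff // oner_neq0.
have [r -> ->] := laurent_of_fracK x; have [s -> ->] := laurent_of_fracK y.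
rewrite -[_ * _ as X in laurent_of_frac X]FracField.pi_mul.
rewrite laurent_of_frac_pi /FracField.mulf.
rewrite !numden_Ratio ?mulf_neq0 ?denom_ratioP //.
by rewrite !rmorphM mulf_div.
Qed.

HB.instance Definition _ := GRing.isZmodMorphism.Build {fraction {poly K}}
  (laurent K) laurent_of_frac laurent_of_frac_is_zmod_morphism.
HB.instance Definition _ := GRing.isMonoidMorphism.Build {fraction {poly K}}
  (laurent K) laurent_of_frac laurent_of_frac_is_monoid_morphism.

End LaurentPoly.

Section FormalPowerSeries.
Variable K : fieldType.
Implicit Types (a : nat -> K) (f u : laurent K).

Lemma pseries_subproof a : exists m : int, forall n : int, n < m ->
  (if n is Posz k then a k else 0) = 0.
Proof. by exists 0 => -[]. Qed.
Definition pseries a : laurent K := Laurent (pseries_subproof a).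

(* Substitution of u in the power series with coefficients a, for u of
   positive valuation: then u ^+ k has no term of degree n < k. *)
Definition pseries_comp a u : laurent K :=
  pseries (fun n => \sum_(k < n.+1) a k * (u ^+ k) n%:Z).

Definition lexp u : laurent K := pseries_comp (fun k => (k`!)%:R^-1) u.

Definition gbinomial (s : K) (k : nat) : K :=
  (\prod_(i < k) (s - i%:R)) / (k`!)%:R.

(* f ^ s through the binomial series, for f with constant term 1. *)
Definition lpow f (s : K) : laurent K := pseries_comp (gbinomial s) (f - 1).

Lemma lderiv_subproof f : exists m : int, forall n : int, n < m ->
  (n + 1)%:~R * f (n + 1) = 0.
Proof.
have [m fm] := lcoefP f; exists (m - 1) => n nm.
by rewrite fm ?mulr0 // -ltrBrDr.
Qed.
Definition lderiv f : laurent K := Laurent (lderiv_subproof f).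

(* The derivatives of f span a finite-dimensional K(X)-vector space. *)
Definition D_finite f : Prop :=
  exists n (g : 'I_n -> laurent K), forall k, exists c : 'I_n -> {fraction {poly K}},
    iter k lderiv f = \sum_(i < n) laurent_of_frac (c i) * g i.

Definition algebraic_function f : Prop := algebraicOver (@laurent_of_frac K) f.

End FormalPowerSeries.

Section IsolatedFixedPoints.
Variables (T : topologicalType) (f : T -> T).

Definition isolated_fixed_points (k : nat) : set T :=
  isolated [set x | iter k f x = x].

(* This is the number of isolated fixed points when it is finite. *)
Definition num_isolated_fixed_points (k : nat) : nat :=
  #|` fset_set (isolated_fixed_points k)|%fset.

Definition fixed_point_series (C : fieldType) : laurent C :=
  pseries (fun k => if k == 0%N then 0 else (num_isolated_fixed_points k)%:R).

Definition artin_mazur_zeta (C : fieldType) : laurent C :=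
  lexp (pseries (fun k => if k == 0%N then 0
                          else (num_isolated_fixed_points k)%:R / k%:R)).

End IsolatedFixedPoints.

Definition RF (F : finFieldType) : Type := laurent F.
HB.instance Definition _ (F : finFieldType) := GRing.Field.on (RF F).

Section Torus.
Variable F : finFieldType.

(* t is the inverse of the uniformizer 1/t, see [coef_poly_XV]. *)
Definition polyt : {poly F} -> RF F := poly_at (lX F)^-1.
HB.instance Definition _ := GRing.RMorphism.on polyt.

Definition absRF (R : numFieldType) (x : RF F) : R :=
  if x == 0 then 0 else #|F|%:R ^ (- lval x).

Definition RF_open (A : set (RF F)) : Prop :=
  forall x, A x -> exists2 e : rat, 0 < e & forall y, absRF rat (y - x) < e -> A y.

Lemma RF_openT : RF_open setT.
Proof. by move=> x _; exists 1. Qed.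

Lemma RF_openI : setI_closed RF_open.
Proof.
move=> A B oA oB x [/oA[e e0 eA] /oB[d d0 dB]]; exists (Num.min e d).
  by rewrite lt_min e0.
by move=> y; rewrite lt_min => /andP[/eA Ay /dB].
Qed.

Lemma RF_open_bigU (I : Type) (f : I -> set (RF F)) :
  (forall i, RF_open (f i)) -> RF_open (\bigcup_i f i).
Proof.
move=> fo x [i _ /fo[e e0 ef]]; exists e => // y /ef fy; by exists i.
Qed.

HB.instance Definition _ := isOpenTopological.Build (RF F)
  RF_openT RF_openI RF_open_bigU.

Definition ZF : RF F -> bool := fun x => `[< exists p, polyt p = x >].

Lemma ZF_zmod_closed : zmod_closed ZF.
Proof.
split=> [|x y /asboolP[p <-] /asboolP[r <-]]; apply/asboolP.
  by exists 0; rewrite rmorph0.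
by exists (p - r); rewrite rmorphB.
Qed.
HB.instance Definition _ := GRing.isZmodClosed.Build (RF F) ZF ZF_zmod_closed.

Local Open Scope quotient_scope.

Definition TF : Type := quotient_topology (Quotient.quot (GRing.ZmodClosed.clone (RF F) ZF _)).
HB.instance Definition _ := Topological.on TF.
HB.instance Definition _ := Quotient.on TF.

Definition RF_mx_act d (A : 'M[{poly F}]_d) (x : 'cV[RF F]_d) : 'cV[RF F]_d :=
  map_mx polyt A *m x.

Definition to_torus d (x : 'cV[RF F]_d) : 'cV[TF]_d := map_mx \pi_TF x.

(* The map induced by [RF_mx_act], as [torus_act_pi] shows; ['cV[TF]_d]
   carries the product topology. *)
Definition torus_act d (A : 'M[{poly F}]_d) (x : 'cV[TF]_d) : 'cV[TF]_d :=
  to_torus (RF_mx_act A (map_mx repr x)).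

Lemma pi_TF_eq (x y : RF F) : \pi_TF x = \pi_TF y <-> ZF (x - y).
Proof.
have := Quotient.idealrBE (GRing.ZmodClosed.clone (RF F) ZF _) x y.
by rewrite /in_mem /= => ->; split => [xy|/eqP //]; exact/eqP.
Qed.

Lemma torus_act_pi d (A : 'M[{poly F}]_d) (x : 'cV[RF F]_d) :
  torus_act A (to_torus x) = to_torus (RF_mx_act A x).
Proof.
apply/matrixP => i j; rewrite !mxE; apply/pi_TF_eq; rewrite -sumrB.
have ZF_sum (I : finType) (G : I -> RF F) : (forall i, ZF (G i)) -> ZF (\sum_i G i).
  move=> ZG; elim/big_rec: _ => [|k y _ /asboolP[p <-]]; apply/asboolP.
    by exists 0; rewrite rmorph0.
  by have /asboolP[r <-] := ZG k; exists (r + p); rewrite rmorphD.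
apply: ZF_sum => k.
rewrite !mxE -mulrBr.
have /pi_TF_eq/asboolP[p <-] : \pi_TF (repr (\pi_TF (x k j))) = \pi_TF (x k j).
  by rewrite reprK.
by apply/asboolP; exists (A i k * p); rewrite rmorphM.
Qed.

End Torus.

Section OrderModP.
Variables (R : realType) (F : finFieldType) (L : closedFieldType).
Variables (iota : {rmorphism RF F -> L}) (absL : L -> R).

Definition is_algebraic_closure : Prop := forall x : L, algebraicOver iota x.

Definition is_abs_extension : Prop :=
  [/\ forall x, absL x = 0 <-> x = 0,
      forall x y, absL (x * y) = absL x * absL y,
      forall x y, absL (x + y) <= absL x + absL y,
      forall x, 0 <= absL x
    & forall x, absL (iota x) = absRF R x].

Definition is_root_of_unity (x : L) : Prop := exists2 n, (0 < n)%N & x ^+ n = 1.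

Section Residue.
Variables (K : fieldExtType (RF F)) (j : {rmorphism K -> L}).

(* The cosets of the maximal ideal {|x| < 1} in the valuation ring {|x| <= 1}. *)
Definition residue_field : set (set K) :=
  [set [set y | absL (j (y - x)) < 1] | x in [set x | absL (j x) <= 1]].
End Residue.

(* The order of alpha modulo p is n, read in some finite extension K, embedded
   in L by j, of F((1/t)): there alpha is a0 + a1, where a0 is 0 or a
   (q ^ delta - 1)-st root of unity, |a1| < 1 and a0 has order n. *)
Definition has_order_mod (alpha : L) (n : nat) : Prop :=
  exists (K : fieldExtType (RF F)) (j : {rmorphism K -> L}) (delta : nat)
         (a0 a1 : K),
    [/\ forall x, j x%:A = iota x,
        (residue_field j #= `I_(#|F| ^ delta))%card
      & [/\ alpha = j (a0 + a1),
            a0 = 0 \/ root ('X^(#|F| ^ delta - 1) - 1) a0,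
            absL (j a1) < 1
          & n.-primitive_root a0]].

End OrderModP.

Definition spectral_r (R : realType) (L : closedFieldType) (absL : L -> R)
    (ev : seq L) : R := \prod_(x <- ev) Num.max 1 (absL x).

Section ZetaFormula.
Variables (C : fieldType) (M : nat) (m : 'I_M -> nat) (r : C).

Definition subset_lcm (I : {set 'I_M}) : nat := \big[lcmn/1%N]_(i in I) m i.

(* The increasing l-tuples of indices are the subsets of cardinality l. *)
Definition zeta_formula : laurent C :=
  let rz := lmono r 1 in
  (1 - rz)^-1 *
  \prod_(1 <= l < M.+1) \prod_(I : {set 'I_M} | #|I| == l)
     lpow (1 - rz ^+ subset_lcm I) ((-1) ^+ l.+1 / (subset_lcm I)%:R).

End ZetaFormula.

(* Main.v *)
From HB Require Import structures.
Require Import Defs.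
From mathcomp Require Import all_boot all_order all_algebra all_field.
From mathcomp Require Import all_classical all_reals all_analysis.
From mathcomp Require Import finmap complex.
From mathcomp Require Import perm zify ring lra.
Set Implicit Arguments.
Unset Strict Implicit.
Unset Printing Implicit Defensive.
Import Order.TTheory GRing.Theory Num.Theory.
Import numFieldNormedType.Exports.
Local Open Scope classical_set_scope.
Local Open Scope complex_scope.
Local Open Scope ring_scope.

(* Fixed points of A^k on the torus form the kernel of B = A^k - 1.  If
   det B <> 0, a Euclidean triangularization shows that this kernel has
   q^(deg det B) = prod |lambda^k - 1| elements, all isolated; if det B = 0,
   it contains the image of a line and no point of it is isolated.
   Factoring the absolute values gives, for k >= 1,
     N_k = r^k prod_i [m_i does not divide k] prod_(j | n_j divides k) c_j^(k_p)
   where c_j = |eta_j^(n_j) - 1| lies strictly between 0 and 1 and k_p is the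
   p-part of k, p being the characteristic of F.

   In case (a) the last product is always 1, and inclusion-exclusion on the
   m_i matches the logarithmic derivatives z f'/f of both sides.

   In case (b), a linear recurrence for N_k with polynomial coefficients would
   be evaluated at indices k, lying in the class of n_j modulo all the m_i and
   n_j', that are divisible by a prescribed high power p^e of p exactly.  All
   other terms of the recurrence do not depend on e, whereas N_k / r^k does:
   hence the coefficient of N_k vanishes.  Finally an algebraic zeta function
   would have a D-finite logarithmic derivative, because C(z)(zeta) is a
   finite-dimensional space stable under derivation. *)

(** * The absolute value of L *)

Section AbsoluteValue.
Variables (R : realType) (L : fieldType) (absL : L -> R) (p : nat).
Hypothesis abs_eq0 : forall x, absL x = 0 <-> x = 0.
Hypothesis absM : forall x y, absL (x * y) = absL x * absL y.
Hypothesis abs_triangle : forall x y, absL (x + y) <= absL x + absL y.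
Hypothesis abs_ge0 : forall x, 0 <= absL x.
Hypothesis pcharL : p \in [pchar L].
#[local] Hint Resolve abs_ge0 : core.

Lemma abs_gt0 x : x != 0 -> 0 < absL x.
Proof.
move=> x0; rewrite lt_neqAle abs_ge0 andbT eq_sym.
by apply/eqP => /abs_eq0/eqP; apply/negP.
Qed.

Lemma abs1 : absL 1 = 1.
Proof.
have /abs_gt0 a1 := oner_neq0 L.
by apply: (mulfI (lt0r_neq0 a1)); rewrite -absM !mulr1.
Qed.

Lemma abs0 : absL 0 = 0. Proof. exact/abs_eq0. Qed.

Lemma absX x k : absL (x ^+ k) = absL x ^+ k.
Proof. by elim: k => [|k IH]; rewrite ?expr0 ?abs1 // !exprS absM IH. Qed.

Lemma abs_prod (I : Type) (s : seq I) (f : I -> L) :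
  absL (\prod_(i <- s) f i) = \prod_(i <- s) absL (f i).
Proof. by apply: (big_morph _ absM abs1). Qed.

Lemma absN x : absL (- x) = absL x.
Proof.
have : absL (-1) ^+ 2 = 1 by rewrite -absX sqrrN expr1n abs1.
move/eqP; rewrite sqrf_eq1 => /orP[/eqP|/eqP] h.
  by rewrite -mulN1r absM h mul1r.
by have := abs_ge0 (-1); rewrite h oppr_ge0 ler10.
Qed.

(* Frobenius gives |x + y|^N <= 2 max(|x|, |y|)^N for every power N of p. *)
Lemma abs_ultra x y (e : R) : absL x <= e -> absL y <= e -> absL (x + y) <= e.
Proof.
move=> xe ye; have e0 : 0 <= e := le_trans (abs_ge0 x) xe.
have pgt1 : (1 < p)%N := prime_gt1 (pcharf_prime pcharL).
move: e0; rewrite le_eqVlt => /orP[/eqP e0|e0].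
  have [ax ay] : absL x = 0 /\ absL y = 0.
    by split; apply/eqP; rewrite eq_le abs_ge0 andbT e0.
  by move/abs_eq0: ax => ->; rewrite add0r ay -e0.
have frob k : (absL (x + y) / e) ^+ (p ^ k) <= 2.
  have -> : (absL (x + y) / e) ^+ (p ^ k) =
            absL (x ^+ (p ^ k) + y ^+ (p ^ k)) / e ^+ (p ^ k).
    rewrite expr_div_n -absX; congr (absL _ / _).
    elim: k => [|k IH]; first by rewrite expn0 !expr1.
    by rewrite !expnSr !exprM IH -!(pFrobenius_autE pcharL) pFrobenius_autD_comm //;
      exact: mulrC.
  rewrite ler_pdivrMr ?exprn_gt0 // (le_trans (abs_triangle _ _)) // !absX.
  by rewrite mulr_natl mulr2n lerD // lerXn2r // nnegrE ?abs_ge0 // ltW.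
rewrite leNgt; apply/negP => ltxy.
have q1 : 1 < absL (x + y) / e by rewrite ltr_pdivlMr // mul1r.
(* Put t = |x + y| / e > 1. Bernoulli's inequality gives t^(p^k) >= 1 + p^k (t - 1), which exceeds 2
   once k > 1 / (t - 1), because p^k > k. *)
have := frob (Num.truncn (absL (x + y) / e - 1)^-1).+1.
set t := absL (x + y) / e in q1 *; set k := _.+1.
rewrite leNgt => /negP; apply.
have tk : 1 + (t - 1) *+ (p ^ k) <= t ^+ (p ^ k).
  elim: (p ^ k)%N => [|N IH]; first by rewrite mulr0n addr0 expr0.
  rewrite exprS; apply: le_trans (_ : t * (1 + (t - 1) *+ N) <= _).
    have : 0 <= (t - 1) * ((t - 1) *+ N).
      by rewrite mulr_ge0 ?mulrn_wge0 // subr_ge0 ltW.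
    by rewrite mulrS; move: ((t - 1) *+ N) => s; nra.
  by rewrite ler_wpM2l // ltW // (lt_trans _ q1).
apply: lt_le_trans tk; rewrite -[2]/(1 + 1) ltrD2l.
have t10 : 0 < t - 1 by rewrite subr_gt0.
rewrite -mulr_natr mulrC -ltr_pdivrMr // mul1r.
apply: lt_le_trans (_ : k%:R <= _).
  by rewrite /k; apply: truncnS_gt.
by rewrite ler_nat ltnW // ltn_expl.
Qed.

Lemma abs_ultra_lt x y (e : R) : absL x < e -> absL y < e -> absL (x + y) < e.
Proof.
move=> xe ye; apply: (@le_lt_trans _ _ (Num.max (absL x) (absL y))).
  by apply: abs_ultra; rewrite le_max lexx ?orbT.
by rewrite gt_max xe.
Qed.

Lemma absD_dominant x y : absL y < absL x -> absL (x + y) = absL x.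
Proof.
move=> yx; apply/eqP; rewrite eq_le abs_ultra ?(ltW yx) //=.
rewrite leNgt; apply/negP => h.
have := abs_ultra_lt h (_ : absL (- y) < absL x).
by rewrite absN addrK ltxx => /(_ yx).
Qed.

Lemma abs_sum_le (I : Type) (s : seq I) (f : I -> L) (e : R) : 0 <= e ->
  (forall i, absL (f i) <= e) -> absL (\sum_(i <- s) f i) <= e.
Proof.
move=> e0 fe; elim/big_rec: _ => [|i x _ xe]; first by rewrite abs0.
exact: abs_ultra.
Qed.

(** All natural numbers have absolute value at most 1, and a Bézout relation with [p] gives a
    natural number that is inverse to [u] in [L]. *)
Lemma abs_natr u : ~~ (p %| u)%N -> absL u%:R = 1.
Proof.
move=> pu; have pp := pcharf_prime pcharL.
have le1 v : absL v%:R <= 1.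
  by elim: v => [|v IH]; rewrite ?abs0 // -natr1 abs_ultra // abs1.
have uN0 : u != 0%N by apply: contraNneq pu => ->; rewrite dvdn0.
have /egcdnP : (0 < u)%N by rewrite lt0n.
move=> /(_ p)[a b eab _]; apply/eqP; rewrite eq_le le1 /=.
have uU : a%:R * u%:R = 1 :> L.
  rewrite -natrM eab natrD natrM (pcharf0 pcharL) mulr0 add0r.
  have /eqP -> : gcdn u p == 1%N by rewrite -/(coprime u p) coprime_sym prime_coprime.
  by [].
have <- : absL a%:R * absL u%:R = 1 by rewrite -absM uU abs1.
by rewrite ler_piMl.
Qed.

Lemma abs_le1X x k : absL x <= 1 -> absL (x ^+ k) <= 1.
Proof. by move=> x1; rewrite absX exprn_ile1. Qed.

(* x^u - 1 is (x - 1)(1 + x + ... + x^(u-1)), whose second factor is u modulo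
   the maximal ideal. *)
Lemma abs_exp_sub1_coprime x u : absL (x - 1) < 1 -> ~~ (p %| u)%N ->
  absL (x ^+ u - 1) = absL (x - 1).
Proof.
move=> x1 pu; rewrite subrX1 absM.
suff -> : absL (\sum_(i < u) x ^+ i) = 1 by rewrite mulr1.
have -> : \sum_(i < u) x ^+ i = u%:R + \sum_(i < u) (x ^+ i - 1).
  by rewrite sumrB sumr_const card_ord addrC subrK.
rewrite absD_dominant ?abs_natr //.
apply: le_lt_trans (x1); apply: abs_sum_le => // i; rewrite subrX1 absM.
rewrite ler_piMr //; apply: abs_sum_le => // j; apply: abs_le1X.
by rewrite -[x](subrK 1) abs_ultra ?abs1 // ltW.
Qed.

Lemma abs_exp_sub1_pchar x e : absL (x ^+ (p ^ e) - 1) = absL (x - 1) ^+ (p ^ e).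
Proof.
rewrite -absX; congr absL; elim: e => [|e IH]; first by rewrite expn0 !expr1.
by rewrite !expnSr !exprM -IH -!(pFrobenius_autE pcharL) rmorphB rmorph1.
Qed.

(** Split k into its p-part and a factor prime to p: the p-part acts through Frobenius, the other
    factor does not change the distance to 1. *)
Lemma abs_exp_sub1_lt1 x k : absL (x - 1) < 1 -> (0 < k)%N ->
  absL (x ^+ k - 1) = absL (x - 1) ^+ (k`_p).
Proof.
move=> x1 k0; have pp := pcharf_prime pcharL.
have pk : ~~ (p %| k`_p^')%N by rewrite -prime_coprime // (pnat_coprime (pnat_id pp)) ?part_pnat.
rewrite -{1}(partnC p k0) exprM p_part abs_exp_sub1_coprime //.
  by rewrite -p_part p_part abs_exp_sub1_pchar.
by rewrite abs_exp_sub1_pchar exprn_ilt1 // -lt0n expn_gt0 prime_gt0.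
Qed.

Lemma abs_lt1_exp_sub1 x k : absL x < 1 -> (0 < k)%N -> absL (x ^+ k - 1) = 1.
Proof.
move=> x1 k0; rewrite addrC absD_dominant absN abs1 // absX.
by rewrite exprn_ilt1 // -lt0n.
Qed.

Lemma abs_gt1_exp_sub1 x k : 1 < absL x -> (0 < k)%N ->
  absL (x ^+ k - 1) = absL x ^+ k.
Proof.
move=> x1 k0; rewrite absD_dominant absX // absN abs1.
by rewrite exprn_egt1 // -lt0n.
Qed.

(** If n = v p, then (z^v - 1)^p = z^n - 1 = 0, so that already z^v = 1. *)
Lemma pchar_prim_root_coprime n (z : L) : n.-primitive_root z -> ~~ (p %| n)%N.
Proof.
move=> zn; apply/negP => /dvdnP[v nv].
have n0 := prim_order_gt0 zn; have pp := pcharf_prime pcharL.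
have /eqP : (z ^+ v - 1) ^+ p = 0.
  rewrite -(pFrobenius_autE pcharL) rmorphB rmorph1 /= pFrobenius_autE -exprM -nv.
  by rewrite prim_expr_order // subrr.
rewrite expf_eq0 prime_gt0 //= subr_eq0 -(prim_order_dvd zn) => /dvdn_leq.
rewrite nv in n0 *; have v0 : (0 < v)%N by case: (v) n0.
by move=> /(_ v0); rewrite leqNgt ltn_Pmulr // prime_gt1.
Qed.

(** If |w - 1| < 1, raising w to a power prime to p would preserve this distance, whereas w^n - 1 =
    0. *)
Lemma abs_root_of_unity_sub1 (w : L) n : w ^+ n = 1 -> ~~ (p %| n)%N -> w != 1 ->
  absL (w - 1) = 1.
Proof.
move=> wn pn w1; have n0 : (0 < n)%N by rewrite lt0n; apply: contraNneq pn => ->.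
have aw : absL w = 1.
  by apply/eqP; rewrite -(@pexpr_eq1 _ _ n) // -absX wn abs1.
apply/eqP; rewrite eq_le abs_ultra ?absN ?aw ?abs1 //= leNgt; apply/negP => lt1.
have := abs_exp_sub1_coprime lt1 pn; rewrite wn subrr abs0.
by move/esym/abs_eq0/eqP; rewrite subr_eq0; apply/negP.
Qed.

(** * Orders modulo the maximal ideal; [z] is the Teichmüller representative of [x] *)

Section ResidueOrder.
Variables (x z : L) (n : nat).
Hypotheses (zn : n.-primitive_root z) (xz : absL (x - z) < 1).

Lemma abs_prim_root : absL z = 1.
Proof.
have n0 := prim_order_gt0 zn.
by apply/eqP; rewrite -(@pexpr_eq1 _ _ n) // -absX prim_expr_order // abs1.
Qed.

Lemma abs_residue_order : absL x = 1.
Proof. by rewrite -[x](subrK z) addrC absD_dominant ?abs_prim_root. Qed.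

Lemma abs_expB_lt1 k : absL (x ^+ k - z ^+ k) < 1.
Proof.
rewrite subrXX absM; apply: le_lt_trans xz; rewrite ler_piMr //.
apply: abs_sum_le => // i.
by rewrite absM !absX abs_residue_order abs_prim_root !expr1n mulr1.
Qed.

Lemma abs_exp_sub1_lt1_dvdn k : (n %| k)%N -> absL (x ^+ k - 1) < 1.
Proof. by rewrite (prim_order_dvd zn) => /eqP zk; rewrite -{1}zk abs_expB_lt1. Qed.

Lemma abs_exp_sub1_ndvdn k : ~~ (n %| k)%N -> absL (x ^+ k - 1) = 1.
Proof.
move=> nk; have -> : x ^+ k - 1 = (z ^+ k - 1) + (x ^+ k - z ^+ k).
  by rewrite [RHS]addrC addrA subrK.
have zk : absL (z ^+ k - 1) = 1.
  apply: (@abs_root_of_unity_sub1 _ n); rewrite -?(prim_order_dvd zn) //.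
    by rewrite exprAC (prim_expr_order zn) expr1n.
  exact: pchar_prim_root_coprime zn.
by rewrite absD_dominant ?zk // abs_expB_lt1.
Qed.

(** When n divides k, the power x^n is close to 1 and k / n has the same p-part as k, since n is
    prime to p. Otherwise x^k is close to z^k, which is at distance 1 from 1. *)
Lemma abs_exp_sub1_residue_order k : (0 < k)%N ->
  absL (x ^+ k - 1) = if (n %| k)%N then absL (x ^+ n - 1) ^+ (k`_p) else 1.
Proof.
move=> k0; case: ifPn => [/dvdnP[v kv]|/abs_exp_sub1_ndvdn//].
have n0 := prim_order_gt0 zn.
have v0 : (0 < v)%N by move: k0; rewrite kv; case: (v).
rewrite kv mulnC exprM abs_exp_sub1_lt1 //; last exact: abs_exp_sub1_lt1_dvdn.
congr (_ ^+ _); rewrite partnM // [(n`_p)%N]part_p'nat ?mul1n //.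
by rewrite p'natE ?(pchar_prim_root_coprime zn) // (pcharf_prime pcharL).
Qed.

(** |(x^n)^N - 1| = 0 is a positive power of |x^n - 1|, hence x^n = 1. *)
Lemma root_of_unity_residue_order k : (0 < k)%N -> (exists2 N, (0 < N)%N & x ^+ N = 1) ->
  absL (x ^+ k - 1) = if (n %| k)%N then 0 else 1.
Proof.
move=> k0 [N N0 xN]; rewrite abs_exp_sub1_residue_order //; case: ifP => // _.
suff -> : absL (x ^+ n - 1) = 0 by rewrite expr0n eqn0Ngt part_gt0.
have := abs_exp_sub1_lt1 (abs_exp_sub1_lt1_dvdn (dvdnn n)) N0.
rewrite exprAC xN expr1n subrr abs0 => /esym/eqP.
by rewrite expf_eq0 => /andP[_ /eqP].
Qed.

End ResidueOrder.
End AbsoluteValue.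

(** Splitting X^k - 1 into factors X - z writes A^k - 1 as the product of the A - z, whose
    determinants are read off the characteristic polynomial at z. Exchanging the two products
    regroups the factors by eigenvalue. *)
Lemma det_exp_sub1 (K : closedFieldType) (d : nat) (A : 'M[K]_d.+1) (ev : seq K) k :
  char_poly A = \prod_(x <- ev) ('X - x%:P) -> (0 < k)%N ->
  \det (A ^+ k - 1) = \prod_(x <- ev) (x ^+ k - 1).
Proof.
move=> Aev k0.
have [zs] := closed_field_poly_normal ('X^k - 1 : {poly K}).
rewrite (monicP (monicXnsubC 1 k0)) scale1r => Xk.
have sz_ev : size ev = d.+1.
  by apply: succn_inj; rewrite -(size_prod_XsubC ev id) -Aev size_char_poly.
have -> : A ^+ k - 1 = \prod_(z <- zs) (A - z%:M).
  transitivity (horner_mx A ('X^k - 1)).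
    by rewrite rmorphB rmorph1 /= rmorphXn /= horner_mx_X.
  rewrite Xk rmorph_prod; apply: eq_bigr => z _.
  by rewrite rmorphB /= horner_mx_X horner_mx_C.
have detZ z : \det (A - z%:M) = \prod_(x <- ev) (x - z).
  have -> : A - z%:M = - (z%:M - A) by rewrite opprB.
  rewrite -scaleN1r detZ.
  have <- : (char_poly A).[z] = \det (z%:M - A).
    rewrite /char_poly -[LHS]/(horner_eval z _) -det_map_mx; congr (\det _).
    apply/matrixP => i j; rewrite !mxE /= /horner_eval !hornerE.
    by case: eqP => _; rewrite ?hornerMn ?hornerX ?mulr1n ?mulr0n ?horner0.
  rewrite Aev horner_prod -sz_ev.
  elim: ev {Aev sz_ev} => [|x s IH]; first by rewrite !big_nil mulr1.
  by rewrite !big_cons -IH /= exprS hornerXsubC mulrACA mulN1r opprB.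
rewrite (big_morph (@determinant _ _) (@det_mulmx _ _) (det1 _ _)).
under eq_bigr do rewrite detZ.
rewrite exchange_big; apply: eq_bigr => x _.
have /(congr1 (horner^~ x)) := Xk.
rewrite !hornerE horner_prod => ->.
by apply: eq_bigr => z _; rewrite !hornerE.
Qed.

Lemma abs_polyt (R : realType) (F : finFieldType) (P : {poly F}) : P != 0 ->
  absRF R (polyt P) = (#|F| ^ (size P).-1)%:R.
Proof.
move=> P0; have sP : (0 < size P)%N by rewrite size_poly_gt0.
have hv : has_val (polyt P) (- ((size P).-1)%:Z).
  split=> [|i]; rewrite /polyt coef_poly_XV.
    rewrite oppr_le0 le0z_nat abszN absz_nat -lead_coefE; apply/eqP.
    by rewrite lead_coef_eq0.
  case: i => [i|i]; first by rewrite ltNge (@le_trans _ _ 0) // oppr_le0.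
  rewrite NegzE ltrN2 ltz_nat abszN absz_nat => iP.
  by rewrite nth_default ?if_same // -(prednK sP).
have Pt0 : polyt P != 0.
  by apply/eqP => h; case: hv => hv _; apply: hv; rewrite h.
by rewrite /absRF (negPf Pt0) (has_val_uniq (lvalP Pt0) hv) opprK -exprnP natrX.
Qed.

(** * Kernels on the torus *)

Section ColumnReduction.
Variable F : fieldType.

Lemma unitmx_transvection n (i j : 'I_n) (q : {poly F}) : i != j ->
  1%:M - q *: delta_mx i j \in unitmx.
Proof.
move=> ij; have := @mulmx1_unit _ _ (1%:M - q *: delta_mx i j) (1%:M + q *: delta_mx i j).
case=> //; rewrite mulmxDr mulmx1 mulmxBl mul1mx -scalemxAl -scalemxAr.
by rewrite mul_delta_mx_0 1?eq_sym // !scaler0 subr0 subrK.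
Qed.

(** Euclid's algorithm by row operations: while two entries are nonzero, reducing the larger modulo
    the other lowers the sum of the sizes. A permutation then brings the last nonzero entry to the
    top. *)
Lemma column_reduction n (c : 'cV[{poly F}]_(1 + n)) :
  exists2 U : 'M[{poly F}]_(1 + n), U \in unitmx & exists g : 'M[{poly F}]_1, U *m c = col_mx g 0.
Proof.
have [s] := ubnP (\sum_i size (c i 0%R))%N.
elim: s c => // s IH c; rewrite ltnS => cs.
have [[i [j [ij cj0 cij]]]|nored] := pselect (exists i j,
    [/\ i != j, c j 0 != 0 & (size (c j 0%R) <= size (c i 0%R))%N]).
  pose E := 1%:M - (c i 0 %/ c j 0) *: delta_mx i j.
  have Ec k : (E *m c) k 0 = if k == i then c i 0 %% c j 0 else c k 0.
    rewrite mulmxBl mul1mx -scalemxAl !mxE (bigD1 j) //= big1 => [|l lj].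
      rewrite mxE eqxx andbT addr0; case: eqP => [->|_].
        by rewrite mul1r {1}(divp_eq (c i 0) (c j 0)) addrC addKr.
      by rewrite mul0r mulr0 subr0.
    by rewrite mxE (negPf lj) andbF mul0r.
  have [|U Uu [g Ug]] := IH (E *m c).
    apply: leq_trans cs; rewrite (bigD1 i) //= [X in (_ < X)%N](bigD1 i) //=.
    rewrite Ec eqxx (eq_bigr (fun k => size (c k 0%R))) => [|k ki]; last first.
      by rewrite Ec (negPf ki).
    by rewrite ltn_add2r (leq_trans _ cij) // ltn_modp.
  exists (U *m E); first by rewrite unitmx_mul Uu unitmx_transvection.
  by exists g; rewrite -mulmxA.
have [[i ci0]|c0] := pselect (exists i, c i 0 != 0); last first.
  exists 1%:M; first exact: unitmx1.
  exists 0; rewrite mul1mx col_mx0; apply/matrixP => i j; rewrite mxE ord1.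
  by apply/eqP; apply: contrapT => /negP ci; apply: c0; exists i.
have cj0 j : j != i -> c j 0 = 0.
  move=> ji; apply/eqP/negPn/negP => cj; apply: nored.
  have [le_ij|/ltnW le_ji] := leqP (size (c i 0%R)) (size (c j 0%R)).
    by exists j, i.
  by exists i, j; rewrite eq_sym.
exists (tperm_mx ord0 i); first exact: unitmx_perm.
exists (\matrix_(_, _) c i 0); rewrite -xrowE; apply/matrixP => k l.
rewrite !mxE ord1; case: splitP => k' kk'; rewrite !mxE.
  by have -> : k = ord0 by [apply: val_inj; rewrite /= kk' ord1]; rewrite tpermL.
apply: cj0; apply/eqP => /(canRL (tpermK _ _)); rewrite tpermR => /(congr1 val) /=.
by rewrite kk'.
Qed.

End ColumnReduction.

Section Enumeration.

(** An explicit parametrization by a finite type, so that the kernel of a block matrix can be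
    counted through a product type. *)
Definition enumerated (T : Type) (S : set T) (N : nat) : Prop :=
  exists (X : finType) (f : X -> T), [/\ injective f, S = range f & #|X| = N].

Lemma enumerated_finite (T : Type) (S : set T) N : enumerated S N -> finite_set S.
Proof. by move=> [X [f [_ -> _]]]; exact: finite_image. Qed.

Lemma enumerated_fset_set (T : choiceType) (S : set T) N :
  enumerated S N -> #|` fset_set S|%fset = N.
Proof.
move=> SN; have Sf := enumerated_finite SN; case: SN => X [f [fI SE <-]].
have -> : fset_set S = [fset f x | x in [fset x in X]]%fset.
  apply/fsetP => y; rewrite in_fset_set // SE; apply/idP/imfsetP => /=.
    by move=> /set_mem[x _ <-]; exists x; rewrite ?in_fset.
  by move=> [x _ ->]; apply/mem_set; exists x.
rewrite card_imfset // card_imfset //=.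
by rewrite -cardE; apply: eq_card.
Qed.
End Enumeration.

Section TorusModule.
Variable F : finFieldType.
Local Notation T := (TF F).
Local Open Scope quotient_scope.

Lemma to_torusE d (x : 'cV[RF F]_d) i j : to_torus x i j = \pi_T (x i j).
Proof. exact: mxE. Qed.

Lemma pi_TF_is_zmod_morphism : zmod_morphism (\pi_T : RF F -> T).
Proof.
pose I := GRing.ZmodClosed.clone (RF F) (@ZF F) _.
move=> x y; transitivity (\pi_T x + \pi_T (- y)).
  exact: (@Quotient.pi_add _ I x (- y)).
by congr (_ + _); exact: (@Quotient.pi_opp _ I y).
Qed.
HB.instance Definition _ := GRing.isZmodMorphism.Build (RF F) T \pi_T
  pi_TF_is_zmod_morphism.

Lemma to_torus_is_zmod_morphism d : zmod_morphism (@to_torus F d).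
Proof. by move=> x y; apply/matrixP => i j; rewrite !mxE; exact: pi_TF_is_zmod_morphism. Qed.
HB.instance Definition _ d := GRing.isZmodMorphism.Build 'cV[RF F]_d 'cV[T]_d
  (@to_torus F d) (@to_torus_is_zmod_morphism d).

Lemma to_torusK d (x : 'cV[T]_d) : to_torus (map_mx repr x) = x.
Proof. by apply/matrixP => i j; rewrite !mxE reprK. Qed.

Lemma pi_TF_eq0 (x : RF F) : \pi_T x = 0 <-> exists P, polyt P = x.
Proof.
have -> : 0 = \pi_T 0 :> T by rewrite raddf0.
by split => [/pi_TF_eq|h]; [|apply/pi_TF_eq]; rewrite subr0; [move/asboolP|apply/asboolP].
Qed.

Lemma to_torus_eq0 d (x : 'cV[RF F]_d) :
  to_torus x = 0 <-> exists P : 'cV[{poly F}]_d, map_mx (@polyt F) P = x.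
Proof.
split=> [x0|[P <-]]; last first.
  by apply/matrixP => i j; rewrite !mxE; apply/pi_TF_eq0; exists (P i j).
have /choice[P Px] i : exists P, polyt P = x i 0.
  by apply/pi_TF_eq0; rewrite -to_torusE x0 mxE.
by exists (\col_i P i); apply/matrixP => i j; rewrite !mxE Px ord1.
Qed.

Lemma to_torus_eq d (x y : 'cV[RF F]_d) :
  to_torus x = to_torus y <-> exists P : 'cV[{poly F}]_d, x - y = map_mx (@polyt F) P.
Proof.
split=> [xy|[P PE]].
  have /to_torus_eq0[P PE] : to_torus (x - y) = 0 by rewrite raddfB /= xy subrr.
  by exists P.
apply: subr0_eq; rewrite -[LHS]/(to_torus x - to_torus y) -raddfB.
by apply/to_torus_eq0; exists P.
Qed.

(* [torus_act] for rectangular matrices *)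
Definition torus_hom m n (A : 'M[{poly F}]_(m, n)) (x : 'cV[T]_n) : 'cV[T]_m :=
  to_torus (map_mx (@polyt F) A *m map_mx repr x).

Lemma torus_hom_pi m n (A : 'M[{poly F}]_(m, n)) (x : 'cV[RF F]_n) :
  torus_hom A (to_torus x) = to_torus (map_mx (@polyt F) A *m x).
Proof.
have /to_torus_eq[P PE] := to_torusK (to_torus x).
by apply/to_torus_eq; exists (A *m P); rewrite -mulmxBr PE map_mxM.
Qed.

Lemma torus_hom_is_zmod_morphism m n (A : 'M[{poly F}]_(m, n)) : zmod_morphism (torus_hom A).
Proof.
move=> x y; rewrite -[x]to_torusK -[y]to_torusK -raddfB !torus_hom_pi.
by rewrite mulmxBr raddfB.
Qed.
HB.instance Definition _ m n (A : 'M[{poly F}]_(m, n)) :=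
  GRing.isZmodMorphism.Build 'cV[T]_n 'cV[T]_m
    (torus_hom A) (torus_hom_is_zmod_morphism A).

Lemma torus_homM m n k (A : 'M[{poly F}]_(m, n)) (B : 'M[{poly F}]_(n, k)) x :
  torus_hom (A *m B) x = torus_hom A (torus_hom B x).
Proof. by rewrite -[x]to_torusK !torus_hom_pi map_mxM mulmxA. Qed.

Lemma torus_homB m n (A B : 'M[{poly F}]_(m, n)) x :
  torus_hom (A - B) x = torus_hom A x - torus_hom B x.
Proof. by rewrite -[x]to_torusK !torus_hom_pi map_mxB mulmxBl raddfB. Qed.

Lemma torus_hom0 m n x : torus_hom (0 : 'M[{poly F}]_(m, n)) x = 0.
Proof. by have := torus_homB (0 : 'M[{poly F}]_(m, n)) 0 x; rewrite !subrr. Qed.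

Lemma torus_hom1 n x : torus_hom (1%:M : 'M[{poly F}]_n) x = x.
Proof. by rewrite -[x in LHS]to_torusK torus_hom_pi map_mx1 mul1mx to_torusK. Qed.

Lemma torus_hom_unit n (U : 'M[{poly F}]_n) x : U \in unitmx -> torus_hom U x = 0 <-> x = 0.
Proof.
move=> Uu; split=> [Ux0|->]; last by rewrite raddf0.
by rewrite -[x]torus_hom1 -(mulVmx Uu) torus_homM Ux0 raddf0.
Qed.

Lemma torus_hom_col m n k (A : 'M[{poly F}]_(m, n)) (B : 'M[{poly F}]_(m, k)) x y :
  torus_hom (row_mx A B) (col_mx x y) = torus_hom A x + torus_hom B y.
Proof.
have -> : col_mx x y = to_torus (col_mx (map_mx repr x) (map_mx repr y)).
  by rewrite /to_torus map_col_mx -!/(to_torus _) !to_torusK.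
by rewrite torus_hom_pi map_row_mx mul_row_col raddfD.
Qed.

Lemma torus_hom_row m n k (A : 'M[{poly F}]_(m, k)) (B : 'M[{poly F}]_(n, k)) x :
  torus_hom (col_mx A B) x = col_mx (torus_hom A x) (torus_hom B x).
Proof. by rewrite /torus_hom map_col_mx mul_col_mx /to_torus map_col_mx. Qed.

Lemma iter_torus_act d (A : 'M[{poly F}]_d.+1) k x :
  iter k (@torus_act F d.+1 A) x = torus_hom (A ^+ k) x.
Proof.
elim: k => [|k IH]; first by rewrite expr0 torus_hom1.
by rewrite iterS IH exprS torus_homM.
Qed.

Definition torus_ker d (A : 'M[{poly F}]_d) : set 'cV[T]_d := [set x | torus_hom A x = 0].

Lemma torus_act_fixed d (A : 'M[{poly F}]_d.+1) k :
  [set x | iter k (@torus_act F d.+1 A) x = x] = torus_ker (A ^+ k - 1).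
Proof.
apply/seteqP; split=> x /=; rewrite iter_torus_act /torus_ker /= torus_homB torus_hom1.
  by move=> ->; rewrite subrr.
exact: subr0_eq.
Qed.

Lemma polyt_inj : injective (@polyt F).
Proof.
move=> P Q PQ; apply/polyP => i.
have := congr1 (fun f : laurent F => f (- i%:Z)) PQ.
by rewrite /polyt !coef_poly_XV oppr_le0 le0z_nat abszN absz_nat.
Qed.

Lemma polyt_eq0 P : (polyt P == 0 :> RF F) = (P == 0).
Proof. by rewrite -(inj_eq polyt_inj) rmorph0. Qed.

Lemma torus_hom_surj1 (g : 'M[{poly F}]_1) : g 0 0 != 0 -> forall y, exists x, torus_hom g x = y.
Proof.
move=> g0 y; exists (to_torus (\col_i (repr (y i 0) / polyt (g 0 0)))).
rewrite torus_hom_pi -[RHS]to_torusK; congr to_torus; apply/matrixP => i j.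
by rewrite !mxE big_ord1 !mxE !ord1 mulrC divfK // polyt_eq0.
Qed.

(** The classes of u / P with deg u < deg P form the kernel of multiplication by P: Euclidean
    division by P provides u, and the degree bound makes it unique. *)
Lemma enumerated_torus_ker1 (g : 'M[{poly F}]_1) : g 0 0 != 0 ->
  enumerated (torus_ker g) (#|F| ^ (size (g 0 0)).-1).
Proof.
move: (g 0 0) (mx11_scalar g) => P -> P0 {g}.
have sP : (0 < size P)%N by rewrite size_poly_gt0.
have Pt0 : polyt P != 0 by rewrite polyt_eq0.
pose y (v : 'rV[F]_(size P).-1) : RF F := polyt (rVpoly v) / polyt P.
exists 'rV[F]_(size P).-1, (fun v => to_torus (const_mx (y v))); split.
- move=> v w /to_torus_eq[Q] /matrixP /(_ 0 0); rewrite !mxE => yvw.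
  have : rVpoly (v - w) = Q 0 0 * P.
    apply: polyt_inj; rewrite rmorphM /= -yvw raddfB rmorphB mulrBl.
    by rewrite !divfK.
  have [Q0|Q0] := eqVneq (Q 0 0) 0.
    rewrite Q0 mul0r => /(congr1 (@poly_rV F (size P).-1)); rewrite rVpolyK raddf0.
    exact: subr0_eq.
  have : (size (rVpoly (v - w)) <= (size P).-1)%N by exact: size_poly.
  move=> /[swap] ->; rewrite size_mul //; move: Q0; rewrite -size_poly_gt0 => Q0.
  by rewrite leqNgt -{1}(prednK Q0) addSn /= -{2}(prednK sP) addnS ltnS leq_addl.
- apply/seteqP; split=> x.
    rewrite /torus_ker /= -{1}[x]to_torusK torus_hom_pi => /to_torus_eq0[Q].
    move=> /matrixP/(_ 0 0); rewrite !mxE big_ord1 !mxE mulr1n => QE.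
    exists (poly_rV (Q 0 0 %% P)) => //; rewrite -[RHS]to_torusK.
    apply/to_torus_eq; exists (const_mx (- (Q 0 0 %/ P))).
    apply/matrixP => i j; rewrite !mxE !ord1 /y poly_rV_K; last first.
      by rewrite -ltnS prednK // ltn_modp.
    apply: (mulIf Pt0); rewrite mulrBl divfK // [repr _ * _]mulrC -QE -!rmorphM -rmorphB.
    by rewrite {2}(divp_eq (Q 0 0) P) mulNr opprD addrCA subrr addr0.
  move=> [v _ <-]; rewrite /torus_ker /= torus_hom_pi; apply/to_torus_eq0.
  exists (const_mx (rVpoly v)); apply/matrixP => i j.
  by rewrite !mxE big_ord1 !mxE !ord1 mulr1n /y mulrC divfK.
- by rewrite card_mx mul1n.
Qed.

End TorusModule.

Section TorusKernelCount.
Variable F : finFieldType.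
Local Notation T := (TF F).

(** Over each x in the kernel of B, the first coordinate solves g x0 = - r x. The solutions form a
    coset of the kernel of g, nonempty because a nonzero polynomial acts surjectively on the torus;
    [s] chooses one of them. *)
Lemma enumerated_torus_ker_block n (g : 'M[{poly F}]_1) (r : 'M[{poly F}]_(1, n))
    (B : 'M[{poly F}]_n) (N : nat) :
  g 0 0 != 0 -> enumerated (torus_ker B) N ->
  enumerated (torus_ker (block_mx g r 0 B)) (#|F| ^ (size (g 0%R 0%R)).-1 * N).
Proof.
move=> g0 [X [f [fI fE <-]]].
have [Y [h [hI hE <-]]] := enumerated_torus_ker1 g0.
have /choice[s sE] (x : 'cV[T]_n) := torus_hom_surj1 g0 (- torus_hom r x).
have blockE (x0 : 'cV[T]_1) (x : 'cV[T]_n) : torus_hom (block_mx g r 0 B) (col_mx x0 x) =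
    col_mx (torus_hom g x0 + torus_hom r x) (torus_hom B x).
  rewrite torus_hom_row !torus_hom_col; congr col_mx.
  by rewrite torus_hom0 add0r.
exists (Y * X)%type, (fun z => col_mx (h z.1 + s (f z.2)) (f z.2)); split.
- move=> [u x] [u' x'] /eq_col_mx[/= + /fI xx']; rewrite xx' => /addIr /hI ->.
  by [].
- apply/seteqP; split=> x.
    rewrite -[x]vsubmxK /torus_ker /= blockE -[X in _ = X -> _]col_mx0.
    move=> /eq_col_mx[gx Bx].
    have [x' _ fx'] : range f (dsubmx x) by rewrite -fE.
    have [u _ hu] : range h (usubmx x - s (dsubmx x)).
      by rewrite -hE /torus_ker /= raddfB /= sE opprK.
    by exists (u, x') => //=; rewrite fx' hu subrK.
  move=> [[u x'] _ <-]; rewrite /torus_ker /= blockE raddfD /= sE.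
  have -> : torus_hom B (f x') = 0.
    by have : torus_ker B (f x') by rewrite fE; exists x'.
  have -> : torus_hom g (h u) = 0.
    by have : torus_ker g (h u) by rewrite hE; exists u.
  by rewrite add0r addNr col_mx0.
- by rewrite card_prod.
Qed.

(** Induction on n: a unimodular U clears the first column below its top entry and changes neither
    the kernel nor the degree of the determinant. *)
Lemma enumerated_torus_ker n (B : 'M[{poly F}]_n) : \det B != 0 ->
  enumerated (torus_ker B) (#|F| ^ (size (\det B)).-1).
Proof.
elim: n B => [|n IH] B; rewrite -?[n.+1]/(1 + n)%N in B *.
  move=> _; rewrite det_mx00 size_poly1 expn0.
  exists unit, (fun=> 0); split=> [[] []//||]; last by rewrite card_unit.
  apply/seteqP; split=> x; first by exists tt => //; apply/matrixP => -[].
  by move=> _; apply/matrixP => -[].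
move=> B0; have [U Uu [g Ug]] := column_reduction (lsubmx B).
set C := U *m rsubmx B; set r := usubmx C; set B' := dsubmx C.
have UBE : U *m B = block_mx g r 0 B'.
  by rewrite -{1}[B]hsubmxK mul_mx_row Ug block_mxEh vsubmxK.
have kerE : torus_ker B = torus_ker (block_mx g r 0 B').
  apply/seteqP; split=> x; rewrite /torus_ker /= -UBE torus_homM.
    by move=> ->; rewrite raddf0.
  by move/(torus_hom_unit _ Uu).
have detE : \det U * \det B = g 0 0 * \det B'.
  by rewrite -det_mulmx UBE det_ublock det_mx11.
have U0 : \det U != 0 by apply: contraTneq Uu => U0; rewrite unitmxE U0 unitr0.
have : g 0 0 * \det B' != 0 by rewrite -detE mulf_neq0.
rewrite mulf_eq0 negb_or => /andP[g0 B'0].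
have -> : (size (\det B)).-1 = ((size (g 0%R 0%R)).-1 + (size (\det B')).-1)%N.
  have := congr1 (fun p : {poly F} => size p) detE.
  move: Uu; rewrite unitmxE poly_unitE => /andP[/eqP sU _].
  rewrite /= !size_mul // sU -[X in X = _ -> _]/(size (\det B)) => ->.
  by move: g0 B'0; rewrite -!size_poly_gt0; case: size => // a; case: size => // b; rewrite addnS.
by rewrite kerE expnD; apply: enumerated_torus_ker_block => //; apply: IH.
Qed.

End TorusKernelCount.

(** * Isolated points of kernels on the torus *)

Section TorusTopology.
Variable F : finFieldType.
Local Notation T := (TF F).
Local Open Scope quotient_scope.

(** Indices count powers of 1/t, so a series without positive indices is a polynomial in t. *)
Lemma polyt_surj_nonpos (f : RF F) : (forall n : int, 0 < n -> f n = 0) ->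
  exists P, polyt P = f.
Proof.
move=> f0; have [m fm] := lcoefP f.
exists (\poly_(i < `|m|%N.+1) f (- i%:Z)); apply: laurentP => n.
rewrite /polyt coef_poly_XV coef_poly; case: ifPn => [n0|]; last first.
  by rewrite -ltNge => /f0.
rewrite lez0_abs // opprK; case: ifPn => // nm.
rewrite fm // ltNge; apply: contraNN nm => mn.
by rewrite ltnS -lez_nat !lez0_abs ?lerN2 // (le_trans mn).
Qed.

Lemma card_field_gt1 (R : numDomainType) : 1 < #|F|%:R :> R.
Proof. by rewrite ltr1n finNzRing_gt1. Qed.

Lemma absRF_ge (R : realFieldType) (x : RF F) (n : int) : x n != 0 ->
  #|F|%:R ^ (- n) <= absRF R x.
Proof.
move=> xn; have x0 : x != 0 by apply: contraNneq xn => ->.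
rewrite /absRF (negPf x0); have [_ hx] := lvalP x0.
by rewrite ler_eXz2l ?card_field_gt1 // lerN2 leNgt; apply: contraNN xn => /hx ->.
Qed.

Lemma absRF_mono_lt (x : RF F) (e : rat) : 0 < e ->
  exists N0, forall N, (N0 <= N)%N -> absRF rat (lmono 1 N%:Z * x : RF F) < e.
Proof.
move=> e0; have [->|x0] := eqVneq x 0.
  by exists 0%N => N _; rewrite mulr0 /absRF eqxx.
(* Here k > 1/e, so q^-k < e; the summand [|lval x|] compensates a negative valuation of x. *)
pose k := (Num.truncn e^-1).+1; exists (k + `|lval x|)%N => N N0.
have [xl xlt] := lvalP x0.
have hv : has_val (lmono 1 N%:Z * x : laurent F) (N%:Z + lval x).
  split=> [|i iN]; rewrite lcoef_monoM mul1r; first by rewrite addrC addKr.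
  by apply: xlt; rewrite ltrBlDl.
have Nx0 : lmono 1 N%:Z * x != 0 :> laurent F.
  by apply/eqP => h; case: hv => + _; rewrite h.
rewrite /absRF (negPf Nx0) (has_val_uniq (lvalP Nx0) hv).
rewrite -invr_expz invf_plt ?posrE ?exprz_gt0 ?(lt_trans _ (card_field_gt1 _)) //.
have kN : k%:Z <= N%:Z + lval x.
  rewrite -lerBlDr; apply: le_trans (_ : k%:Z + `|lval x|%N%:Z <= _).
    by rewrite lerD2l -abszN abszE ler_norm.
  by rewrite -PoszD lez_nat.
apply: lt_le_trans (_ : k%:R <= _); first exact: truncnS_gt.
apply: le_trans (_ : #|F|%:R ^ k%:Z <= _).
  by rewrite -exprnP -natrX ler_nat ltnW // ltn_expl // finNzRing_gt1.
by rewrite ler_eXz2l // card_field_gt1.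
Qed.

(** If x and y have distinct classes, x - y has a nonzero coefficient at some n > 0. A perturbation
    of x smaller than q^-n keeps it, and polynomials have no such coefficient. *)
Lemma open_pi_TF_neq (y : RF F) : open [set z : T | z <> \pi_T y].
Proof.
(* By conversion, a set is open in the quotient when its preimage is open. *)
suff : RF_open [set x : RF F | \pi_T x <> \pi_T y] by [].
move=> x /= xy; have [n [n0 xyn]] : exists n : int, 0 < n /\ (x - y) n != 0.
  apply: contrapT => h; apply: xy; apply/pi_TF_eq/asboolP/polyt_surj_nonpos => n n0.
  by apply/eqP/negPn/negP => xyn; apply: h; exists n.
exists (#|F|%:R ^ (- n)); first by rewrite exprz_gt0 // (lt_trans _ (card_field_gt1 _)).
move=> z zx /pi_TF_eq/asboolP[P PE].
have : (z - x) n != 0.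
  have -> : z - x = polyt P - (x - y) by rewrite PE opprB addrA subrK.
  rewrite lcoefD lcoefN /polyt coef_poly_XV leNgt n0 add0r oppr_eq0 //.
by move/(absRF_ge rat); rewrite leNgt zx.
Qed.

Lemma torus_accessible d : accessible_space 'cV[T]_d.
Proof.
move=> x y xy; have [i xyi] : exists i, x i 0 <> y i 0.
  apply: contrapT => h; move/eqP: xy; apply; apply/matrixP => i j; rewrite ord1.
  by apply: contrapT => xyi; apply: h; exists i.
exists [set z : 'cV[T]_d | z i 0 <> y i 0]; split; last 2 first.
- exact/mem_set.
- by apply/mem_set => /=; apply.
rewrite openE => z /= zy.
exists (fun k _ => if k == i then [set u | u <> y i 0] else setT) => [k l|w /(_ i 0) /=].
  case: eqP => [->|_]; last exact: filterT.
  rewrite ord1; apply: open_nbhs_nbhs; split=> //.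
  by rewrite -[y i 0]reprK; exact: open_pi_TF_neq.
by rewrite eqxx.
Qed.

(** In an accessible space finite sets are closed, so the complement of S minus x is a neighbourhood
    of x that isolates it in S. *)
Lemma isolated_finite_torus d (S : set 'cV[T]_d) : finite_set S -> isolated S = S.
Proof.
move=> Sf; apply/seteqP; split=> [|x Sx]; first exact: isolatedS.
split; first exact/mem_set.
exists (~` (S `\ x)); last first.
  apply/seteqP; split=> [y [/= Sxy Sy]|y ->]; last by split=> // -[_]; apply.
  by apply: contrapT => yx; apply: Sxy.
apply: open_nbhs_nbhs; split; last by move=> [_]; apply.
apply: closed_openC; apply: (accessible_finite_set_closed.1 (@torus_accessible d)).
by apply: sub_finite_set Sf => y [].
Qed.

(** A nonzero polynomial vector v with B v = 0 gives the kernel points x + t^-N v, which tend to x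
    and differ from x for large N. *)
Lemma isolated_torus_ker_det0 d (B : 'M[{poly F}]_d) : \det B = 0 ->
  isolated (torus_ker B) = set0.
Proof.
rewrite -det_tr => /eqP/det0P[v v0 vB]; apply/seteqP; split=> // x [/set_mem Bx].
move=> [V [P xP PV] VE].
have [i vi0] : exists i, v 0 i != 0.
  apply: contrapT => h; move/eqP: v0; apply; apply/matrixP => k i; rewrite ord1 mxE.
  by apply/eqP/negPn/negP => vi; apply: h; exists i.
pose u : 'cV[RF F]_d := map_mx (@polyt F) v^T.
pose y N : 'cV[T]_d := x + to_torus ((lmono 1 N%:Z : RF F) *: u).
have yker N : torus_ker B (y N).
  rewrite /torus_ker /= raddfD /= Bx add0r torus_hom_pi -scalemxAr -map_mxM.
  by rewrite -[B]trmxK -trmx_mul vB trmx0 map_mx0 scaler0 raddf0.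
have [N0 N0P] : exists N0, forall N, (N0 <= N)%N -> V (y N).
  have /choice[n nP] k : exists n, forall N, (n <= N)%N -> P k 0 (y N k 0).
    have Pk : nbhs (\pi_T (repr (x k 0))) (P k 0) by rewrite reprK; exact: xP.
    have : nbhs (repr (x k 0)) [set z | P k 0 (\pi_T z)] := pi_continuous Pk.
    rewrite nbhsE => -[W [oW Wx] WP].
    have [e e0 eO] : exists2 e : rat, 0 < e &
        forall z, absRF rat (z - repr (x k 0)) < e -> W z.
      by have /(_ _ Wx) := (oW : RF_open W).
    have [n nP] := absRF_mono_lt (polyt (v 0 k)) e0.
    exists n => N /nP ltN; rewrite /y !mxE -[x k 0]reprK -raddfD.
    by apply: WP; apply: eO; rewrite addrC addKr.
  exists (\max_k n k)%N => N nN; apply: PV => k l; rewrite ord1; apply: nP.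
  exact: leq_trans (leq_bigmax _) nN.
(* The second bound puts the leading coefficient of t^-N v_i at a positive index, where a polynomial
   in t has none; hence [y N] differs from x. *)
pose N := maxn N0 (size (v 0 i)).+1.
have : (V `&` torus_ker B) (y N) by split=> //; apply: N0P; exact: leq_maxl.
rewrite VE /= => yx.
have /to_torus_eq0[Q] : to_torus ((lmono 1 N%:Z : RF F) *: u) = 0.
  by apply: (addrI x); rewrite addr0.
move=> /matrixP/(_ i 0); rewrite !mxE.
move=> /(congr1 (fun f : laurent F => f (N%:Z - ((size (v 0 i)).-1)%:Z))).
have vN : ((size (v 0%R i)).-1 < N)%N.
  by rewrite /N (leq_trans _ (leq_maxr _ _)) // ltnS leq_pred.
rewrite lcoef_monoM mul1r addrAC subrr add0r /polyt !coef_poly_XV subr_le0 lez_nat leqNgt vN /=.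
rewrite oppr_le0 le0z_nat abszN absz_nat -lead_coefE => /esym/eqP.
by rewrite lead_coef_eq0 (negPf vi0).
Qed.

End TorusTopology.

(** * The number of isolated fixed points in terms of eigenvalues *)

Section FixedPointCount.
Variable F : finFieldType.

Lemma isolated_fixed_points_torus d (A : 'M[{poly F}]_d.+1) k :
  isolated_fixed_points (@torus_act F d.+1 A) k =
  if \det (A ^+ k - 1) == 0 then set0 else torus_ker (A ^+ k - 1).
Proof.
rewrite /isolated_fixed_points torus_act_fixed; case: eqP => [/isolated_torus_ker_det0//|/eqP].
by move=> /enumerated_torus_ker/enumerated_finite/isolated_finite_torus.
Qed.

Lemma finite_isolated_fixed_points_torus d (A : 'M[{poly F}]_d.+1) k :
  finite_set (isolated_fixed_points (@torus_act F d.+1 A) k).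
Proof.
rewrite isolated_fixed_points_torus; case: eqP => [_|/eqP]; first exact: finite_set0.
by move=> /enumerated_torus_ker/enumerated_finite.
Qed.

(** The formula covers a zero determinant too: no fixed point is then isolated, and |0| = 0. *)
Lemma num_isolated_fixed_points_torus (R : realType) d (A : 'M[{poly F}]_d.+1) k :
  (num_isolated_fixed_points (@torus_act F d.+1 A) k)%:R =
  absRF R (polyt (\det (A ^+ k - 1))).
Proof.
rewrite /num_isolated_fixed_points isolated_fixed_points_torus; case: eqP => [->|/eqP det0].
  have -> : polyt 0 = 0 :> RF F by exact: rmorph0.
  by rewrite fset_set0 cardfs0 /absRF eqxx.
by rewrite abs_polyt // (enumerated_fset_set (enumerated_torus_ker det0)).
Qed.

Variables (R : realType) (L : closedFieldType) (iota : {rmorphism RF F -> L}) (absL : L -> R).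
Hypothesis extL : is_abs_extension iota absL.

Lemma pchar_closure p : p \in [pchar F] -> p \in [pchar L].
Proof. by move=> pF; apply: (rmorph_pchar iota); apply: (rmorph_pchar (@lconst F)). Qed.

(** The witness is the image in [L] of the Teichmüller part [a0]; this is the form in which orders
    enter the estimates of |x^k - 1|. *)
Lemma has_order_mod_prim_root x n : has_order_mod iota absL x n ->
  exists2 z, n.-primitive_root z & absL (x - z) < 1.
Proof.
case=> K [j [delta [a0 [a1 [_ _ [-> _ a1lt zn]]]]]]; exists (j a0).
  by rewrite fmorph_primitive_root.
by rewrite rmorphD /= addrC addKr.
Qed.

Lemma num_isolated_fixed_points_eigenvalues d (A : 'M[{poly F}]_d.+1) (ev : seq L) k :
  map_poly (iota \o @polyt F) (char_poly A) = \prod_(x <- ev) ('X - x%:P) -> (0 < k)%N ->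
  (num_isolated_fixed_points (@torus_act F d.+1 A) k)%:R = \prod_(x <- ev) absL (x ^+ k - 1).
Proof.
have [a0 aM aD age aE] := extL.
move=> evP k0; rewrite num_isolated_fixed_points_torus -aE -(abs_prod a0 aM age).
congr absL; rewrite -[LHS]/((iota \o @polyt F) _) -det_map_mx.
rewrite -(det_exp_sub1 _ k0 (A := map_mx (iota \o @polyt F) A)); last first.
  by rewrite -map_char_poly.
by rewrite rmorphB rmorphXn rmorph1.
Qed.

Variable p : nat.
Hypothesis pF : p \in [pchar F].

Lemma num_isolated_fixed_points_formula d (A : 'M[{poly F}]_d.+1) (ev mu eta : seq L)
    (m : 'I_(size mu) -> nat) (n : 'I_(size eta) -> nat) k :
  map_poly (iota \o @polyt F) (char_poly A) = \prod_(x <- ev) ('X - x%:P) ->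
  perm_eq mu [seq x <- ev | `[< is_root_of_unity x >]] ->
  perm_eq eta [seq x <- ev | (absL x == 1) && ~~ `[< is_root_of_unity x >]] ->
  (forall i : 'I_(size mu), has_order_mod iota absL mu`_i (m i)) ->
  (forall j : 'I_(size eta), has_order_mod iota absL eta`_j (n j)) ->
  (0 < k)%N ->
  (num_isolated_fixed_points (@torus_act F d.+1 A) k)%:R =
  spectral_r absL ev ^+ k * \prod_i (if (m i %| k)%N then 0 else 1) *
  \prod_(j < size eta) (if (n j %| k)%N then absL (eta`_j ^+ n j - 1) ^+ (k`_p) else 1).
Proof.
move=> evP muP etaP mP nP k0; rewrite (num_isolated_fixed_points_eigenvalues evP k0).
have [a0 aM aD age aE] := extL; have pL := pchar_closure pF.
(* [h] keeps the eigenvalues on the unit circle. The others contribute 1 or |x|^k according as |x| <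
   1 or |x| > 1, that is max(1, |x|)^k, and make up the power of r. *)
pose h x := if absL x == 1 then absL (x ^+ k - 1) else 1.
have -> : \prod_(x <- ev) absL (x ^+ k - 1) = spectral_r absL ev ^+ k * \prod_(x <- ev) h x.
  rewrite /spectral_r -prodrXl -big_split; apply: eq_bigr => x _; rewrite /h /=.
  case: ltgtP => [x1|x1|x1]; rewrite ?expr1n ?mulr1 ?mul1r //.
  - by rewrite (abs_lt1_exp_sub1 a0 aM aD age pL).
  - by rewrite (abs_gt1_exp_sub1 a0 aM aD age pL).
  - by rewrite x1 expr1n mul1r.
rewrite -mulrA; congr (_ * _).
rewrite (bigID (fun x => `[< is_root_of_unity x >])) /=; congr (_ * _).
  rewrite -big_filter -(perm_big _ muP) (big_nth 0) big_mkord; apply: eq_bigr => i _.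
  have [z zm xz] := has_order_mod_prim_root (mP i).
  rewrite /h (abs_residue_order a0 aM aD age pL zm xz) eqxx.
  apply: (root_of_unity_residue_order a0 aM aD age pL zm xz) => //.
  have : mu`_i \in mu by apply: mem_nth.
  by rewrite (perm_mem muP) mem_filter => /andP[/asboolP].
rewrite -big_filter (bigID (fun x => absL x == 1)) /= [X in _ * X]big1 ?mulr1; last first.
  by move=> x /negPf x1; rewrite /h x1.
rewrite -big_filter -filter_predI -(perm_big _ etaP) (big_nth 0) big_mkord.
apply: eq_bigr => i _.
have [z zm xz] := has_order_mod_prim_root (nP i).
rewrite /h (abs_residue_order a0 aM aD age pL zm xz) eqxx.
exact: (abs_exp_sub1_residue_order a0 aM aD age pL zm xz).
Qed.

(** The lower bound is strict because eta_j is not a root of unity, the upper one because n_j is the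
    order of its residue. *)
Lemma residue_defect_bounds (ev eta : seq L) (n : 'I_(size eta) -> nat) (j : 'I_(size eta)) :
  perm_eq eta [seq x <- ev | (absL x == 1) && ~~ `[< is_root_of_unity x >]] ->
  has_order_mod iota absL eta`_j (n j) ->
  0 < absL (eta`_j ^+ n j - 1) < 1.
Proof.
move=> etaP /has_order_mod_prim_root[z zn xz].
have [a0 aM aD age aE] := extL; have pL := pchar_closure pF.
rewrite (abs_exp_sub1_lt1_dvdn a0 aM aD age pL zn xz) // andbT.
apply: abs_gt0 => //; rewrite subr_eq0; apply/eqP => xn.
have : eta`_j \in eta by apply: mem_nth.
rewrite (perm_mem etaP) mem_filter => /andP[/andP[_ /asboolP]]; case.
by exists (n j) => //; exact: prim_order_gt0 zn.
Qed.

Lemma has_order_mod_coprime x n : has_order_mod iota absL x n -> (0 < n)%N && ~~ (p %| n)%N.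
Proof.
move=> /has_order_mod_prim_root[z zn xz]; rewrite (prim_order_gt0 zn).
exact: (pchar_prim_root_coprime (pchar_closure pF) zn).
Qed.

End FixedPointCount.

(** * Formal Laurent series and the Euler derivation *)

Section EulerDerivation.
Variable C : fieldType.
Implicit Types (f g u : laurent C) (a b : nat -> C).

Lemma ltheta_subproof f : exists m : int, forall n : int, n < m -> n%:~R * f n = 0.
Proof. by have [m fm] := lcoefP f; exists m => n /fm ->; rewrite mulr0. Qed.
(** The derivation z d/dz is preferred to d/dz because it acts diagonally on coefficients and so
    preserves bounds on the valuation. *)
Definition ltheta f : laurent C := Laurent (ltheta_subproof f).

Lemma lcoef_theta f n : ltheta f n = n%:~R * f n. Proof. by []. Qed.

Lemma lderiv_theta f : lderiv f = lmono 1 (-1) * ltheta f.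
Proof. by apply: laurentP => n; rewrite lcoef_monoM mul1r opprK. Qed.

Lemma ltheta_is_zmod_morphism : zmod_morphism ltheta.
Proof. by move=> f g; apply: laurentP => n; rewrite /= mulrBr. Qed.
HB.instance Definition _ := GRing.isZmodMorphism.Build (laurent C) (laurent C)
  ltheta ltheta_is_zmod_morphism.

Lemma int_lt_or_ge (m n : int) : n < m \/ exists k : nat, n = m + k%:Z.
Proof.
have [nm|mn] := ltP n m; [by left|right].
by exists `|n - m|%N; rewrite gez0_abs ?subr_ge0 // [m + _]addrC subrK.
Qed.

Lemma int_lt_nat (n : int) : exists M : nat, n < M%:Z.
Proof. by exists `|n|%N.+1; rewrite (le_lt_trans (ler_norm n)) // -abszE ltz_nat. Qed.

Lemma vanishes_theta f m : vanishes_below f m -> vanishes_below (ltheta f) m.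
Proof. by move=> fm n /fm /= ->; rewrite mulr0. Qed.

Lemma vanishesM f g m m' : vanishes_below f m -> vanishes_below g m' ->
  vanishes_below (f * g) (m + m').
Proof. by move=> fm gm n; exact: lmul_coef_lt. Qed.

Lemma vanishes_le f m m' : m' <= m -> vanishes_below f m -> vanishes_below f m'.
Proof. by move=> mm' fm n nm'; apply: fm; exact: lt_le_trans mm'. Qed.

(** In the Cauchy product, the index of the term f_i g_j splits as i + j. *)
Lemma lthetaM f g : ltheta (f * g) = ltheta f * g + f * ltheta g.
Proof.
have [m fm] := lcoefP f; have [m' gm] := lcoefP g.
have tfm := vanishes_theta fm; have tgm := vanishes_theta gm.
apply: laurentP => n; rewrite lcoefD.
have [nm|[k ->]] := int_lt_or_ge (m + m') n.
  rewrite (vanishesM tfm gm nm) (vanishesM fm tgm nm).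
  by rewrite (vanishes_theta (vanishesM fm gm) nm) addr0.
rewrite /= !(lmul_coefE k) // mulr_sumr -big_split; apply: eq_bigr => j _ /=.
have jk : (j <= k)%N by rewrite -ltnS.
have -> : m + m' + k = (m + j%:Z) + (m' + (k - j)%N%:Z).
  by rewrite addrACA -PoszD subnKC.
by rewrite rmorphD mulrDl /= mulrA [f _ * (_ * _)]mulrCA.
Qed.

Lemma ltheta_mono c m : ltheta (lmono c m) = lmono (m%:~R * c) m.
Proof. by apply: laurentP => n /=; case: eqP => [->|]; rewrite ?mulr0. Qed.

Lemma ltheta_const c : ltheta (lconst c) = 0.
Proof. by rewrite ltheta_mono mul0r; apply: laurentP => n /=; case: ifP. Qed.

Lemma ltheta1 : ltheta 1 = 0.
Proof. by rewrite -[1]lmono1 ltheta_const. Qed.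

Lemma lthetaX f n : ltheta (f ^+ n.+1) = lconst n.+1%:R * f ^+ n * ltheta f.
Proof.
elim: n => [|n IH]; first by rewrite expr0 rmorph1 !mul1r expr1.
rewrite exprS lthetaM IH -natr1 rmorphD rmorph1 exprS.
by ring.
Qed.

Lemma ltheta_sum I (r : seq I) (P : pred I) (G : I -> laurent C) :
  ltheta (\sum_(i <- r | P i) G i) = \sum_(i <- r | P i) ltheta (G i).
Proof. exact: raddf_sum. Qed.

Lemma lcoef_constM c f n : (lconst c * f) n = c * f n.
Proof. by rewrite lcoef_monoM subr0. Qed.

(** Below index M, substitution of a series u of positive valuation agrees with this finite sum, on
    which identities can be checked algebraically. *)
Definition comp_trunc a u M : laurent C := \sum_(k < M) lconst (a k) * u ^+ k.

Section Composition.
Variable u : laurent C.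
Hypothesis u1 : vanishes_below u 1.

Lemma vanishes_exp k : vanishes_below (u ^+ k) k%:Z.
Proof.
elim: k => [|k IH]; first by rewrite expr0 -lmono1 => n /= /lt_eqF ->.
by rewrite exprS -add1n PoszD; exact: vanishesM.
Qed.

Lemma pseries_comp_trunc a M (n : int) : n < M%:Z ->
  pseries_comp a u n = comp_trunc a u M n.
Proof.
rewrite /comp_trunc lcoef_sum; case: n => n nM; rewrite [LHS]/=; last first.
  rewrite big1 // => k _; rewrite lcoef_constM.
  by rewrite vanishes_exp ?mulr0.
rewrite ltz_nat in nM; rewrite (big_ord_widen_cond M xpredT (fun k => a k * (u ^+ k) n%:Z)) //.
rewrite big_mkcond; apply: eq_bigr => k _; rewrite lcoef_constM.
by case: ltnP => // nk; rewrite vanishes_exp ?mulr0 // ltz_nat.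
Qed.

Lemma pseries_compB_vanishes a M : vanishes_below (pseries_comp a u - comp_trunc a u M) M.
Proof. by move=> n nM; rewrite lcoefD lcoefN (pseries_comp_trunc _ nM) subrr. Qed.

Lemma mul_pseries_comp_trunc g a M : vanishes_below g 0 ->
  forall n : int, n < M%:Z -> (g * pseries_comp a u) n = (g * comp_trunc a u M) n.
Proof.
move=> g0 n nM; apply/eqP; rewrite -subr_eq0 -lcoefN -lcoefD -mulrBr.
by rewrite -[M%:Z]add0r in nM; rewrite (vanishesM g0 (@pseries_compB_vanishes a M)).
Qed.

Lemma pseries_comp_theta a : ltheta (pseries_comp a u) =
  ltheta u * pseries_comp (fun k => k.+1%:R * a k.+1) u.
Proof.
apply: laurentP => n; have [M nM] := int_lt_nat n.
(* The left-hand side is truncated one term later, since differentiating u^(k+1) leaves u^k. *)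
have nM1 : n < M.+1%:Z by rewrite (lt_trans nM) // ltz_nat.
rewrite (@mul_pseries_comp_trunc _ _ M) //; last first.
  by apply: vanishes_theta; apply: vanishes_le u1.
rewrite lcoef_theta (pseries_comp_trunc _ nM1) -lcoef_theta; congr (lcoef _ n).
rewrite /comp_trunc ltheta_sum big_ord_recl expr0 mulr1 ltheta_const add0r mulr_sumr.
apply: eq_bigr => k _; rewrite lthetaM ltheta_const mul0r add0r lthetaX.
by rewrite /bump /= ?add1n rmorphM /=; ring.
Qed.

Lemma mul_pseries_comp a : u * pseries_comp a u =
  pseries_comp (fun k => if k is j.+1 then a j else 0) u.
Proof.
apply: laurentP => n; have [M nM] := int_lt_nat n.
have nM1 : n < M.+1%:Z by rewrite (lt_trans nM) // ltz_nat.
rewrite (@mul_pseries_comp_trunc _ _ M) //; last by apply: vanishes_le u1.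
rewrite (pseries_comp_trunc _ nM1); congr (lcoef _ n).
rewrite /comp_trunc big_ord_recl /= rmorph0 mul0r add0r mulr_sumr.
by apply: eq_bigr => k _; rewrite /bump /= ?add1n exprS; ring.
Qed.

Lemma pseries_compD a b : pseries_comp (fun k => a k + b k) u =
  pseries_comp a u + pseries_comp b u.
Proof.
apply: laurentP => -[] n; rewrite lcoefD /= ?addr0 // -big_split /=.
by apply: eq_bigr => k _; rewrite mulrDl.
Qed.

Lemma pseries_compZ c a : pseries_comp (fun k => c * a k) u = lconst c * pseries_comp a u.
Proof.
apply: laurentP => -[] n; rewrite lcoef_constM /= ?mulr0 // mulr_sumr.
by apply: eq_bigr => k _; rewrite mulrA.
Qed.

Lemma eq_pseries_comp a b : a =1 b -> pseries_comp a u = pseries_comp b u.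
Proof. by move=> /funext ->. Qed.

Lemma pseries_comp_vanishes a : vanishes_below (pseries_comp a u) 0.
Proof. by case. Qed.

Lemma pseries_comp0 a : pseries_comp a u 0 = a 0%N.
Proof. by rewrite /= big_ord1 expr0 /= mulr1. Qed.

End Composition.
End EulerDerivation.

(** * Logarithmic derivatives of exponentials and binomial powers *)

Section LogDerivative.
Variable C : numFieldType.
Implicit Types (f g u : laurent C).

Definition unit_series f : Prop := vanishes_below f 0 /\ f 0 = 1.

Lemma unit_series_neq0 f : unit_series f -> f != 0.
Proof. by move=> [_ f0]; apply/eqP => fz; move/eqP: f0; rewrite fz /= eq_sym oner_eq0. Qed.

Lemma lcoefM_lowest f g m m' : vanishes_below f m -> vanishes_below g m' ->
  (f * g) (m + m') = f m * g m'.
Proof.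
move=> fm gm; rewrite -[m + m']addr0.
by rewrite [LHS](lmul_coefE 0 fm gm) big_ord1 !addr0.
Qed.

Lemma unit_series1 : unit_series 1.
Proof. by split=> // n /= /lt_eqF ->. Qed.

Lemma unit_seriesM f g : unit_series f -> unit_series g -> unit_series (f * g).
Proof.
move=> [fv f0] [gv g0]; split; first by rewrite -[0]addr0; exact: vanishesM.
by rewrite -[X in (f * g) X]addr0 lcoefM_lowest // f0 g0 mulr1.
Qed.

Lemma unit_series_prod (I : Type) (r : seq I) (P : pred I) (G : I -> laurent C) :
  (forall i, P i -> unit_series (G i)) -> unit_series (\prod_(i <- r | P i) G i).
Proof. by move=> uG; apply: big_ind => //; [exact: unit_series1|exact: unit_seriesM]. Qed.

Lemma unit_seriesX f n : unit_series f -> unit_series (f ^+ n).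
Proof.
move=> uf; elim: n => [|n IH]; first by rewrite expr0; exact: unit_series1.
by rewrite exprS; exact: unit_seriesM.
Qed.

Lemma unit_seriesV f : unit_series f -> unit_series f^-1.
Proof.
move=> uf; have f0 := unit_series_neq0 uf.
have [b [fVb Vb]] := has_val_ex (invr_neq0 f0).
have [fv f01] := uf; have := lcoefM_lowest fv Vb.
rewrite mulfV // f01 mul1r add0r /= => bE.
have b0 : b = 0 by apply/eqP/negPn/negP => /negPf b0; apply: fVb; rewrite -bE b0.
by split; rewrite -b0 // -bE b0.
Qed.

(** This is z f'/f, which turns the products and exponents of the zeta formula into sums and
    multiples. *)
Definition logtheta f : laurent C := ltheta f / f.

Lemma logthetaM f g : f != 0 -> g != 0 -> logtheta (f * g) = logtheta f + logtheta g.
Proof.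
by move=> f0 g0; rewrite /logtheta lthetaM invfM; field; rewrite f0 g0.
Qed.

Lemma logtheta1 : logtheta 1 = 0.
Proof. by rewrite /logtheta ltheta1 mul0r. Qed.

Lemma logtheta_prod (I : Type) (r : seq I) (P : pred I) (G : I -> laurent C) :
  (forall i, P i -> G i != 0) ->
  logtheta (\prod_(i <- r | P i) G i) = \sum_(i <- r | P i) logtheta (G i).
Proof.
move=> G0; pose K f s := f != 0 /\ logtheta f = s.
suff [] : K (\prod_(i <- r | P i) G i) (\sum_(i <- r | P i) logtheta (G i)) by [].
apply: big_ind2; first by split; [exact: oner_neq0|exact: logtheta1].
  by move=> f s g t [f0 <-] [g0 <-]; split; [exact: mulf_neq0|exact: logthetaM].
by move=> i /G0.
Qed.

Lemma logthetaX f n : f != 0 -> logtheta (f ^+ n) = logtheta f *+ n.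
Proof.
move=> f0; elim: n => [|n IH]; first by rewrite expr0 logtheta1.
by rewrite exprS mulrS logthetaM ?expf_neq0 // IH.
Qed.

Lemma logthetaV f : f != 0 -> logtheta f^-1 = - logtheta f.
Proof.
move=> f0; apply/eqP; rewrite -addr_eq0 addrC -logthetaM ?invr_eq0 //.
by rewrite divff // logtheta1.
Qed.

Lemma ltheta_eq0 f : ltheta f = 0 -> f = lconst (f 0).
Proof.
move=> tf; apply: laurentP => n /=; case: eqP => [->//|/eqP n0].
have /eqP := congr1 (fun g : laurent C => g n) tf.
by rewrite lcoef_theta mulf_eq0 intr_eq0 (negPf n0) /= => /eqP.
Qed.

(** The quotient f / g is killed by z d/dz, hence constant in characteristic 0, and its constant
    term is 1. *)
Lemma logtheta_inj f g : unit_series f -> unit_series g ->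
  logtheta f = logtheta g -> f = g.
Proof.
move=> uf ug fg; have [f0 g0] := (unit_series_neq0 uf, unit_series_neq0 ug).
have /ltheta_eq0 : ltheta (f / g) = 0.
  have : logtheta (f / g) = 0 by rewrite logthetaM ?invr_eq0 // logthetaV // fg subrr.
  by move/eqP; rewrite mulf_eq0 invr_eq0 mulf_eq0 invr_eq0 (negPf f0) (negPf g0) !orbF => /eqP.
have [_ ->] := unit_seriesM uf (unit_seriesV ug).
by rewrite rmorph1 => fg1; rewrite -[f](divfK g0) fg1 mul1r.
Qed.

Lemma unit_series_lexp u : vanishes_below u 1 -> unit_series (lexp u).
Proof.
move=> u1; split; first exact: pseries_comp_vanishes.
by rewrite /lexp pseries_comp0 fact0 invr1.
Qed.

Lemma logtheta_lexp u : vanishes_below u 1 -> logtheta (lexp u) = ltheta u.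
Proof.
move=> u1; rewrite /logtheta {1}/lexp pseries_comp_theta //.
rewrite (eq_pseries_comp u (b := fun k => k`!%:R^-1)).
  by rewrite -/(lexp u) mulfK // unit_series_neq0 //; exact: unit_series_lexp.
by move=> k; rewrite factS natrM invfM mulrA divff ?mul1r // pnatr_eq0.
Qed.

Lemma unit_series_vanishes_sub1 f : unit_series f -> vanishes_below (f - 1) 1.
Proof.
move=> [fv f0] n; rewrite lcoefD lcoefN /= => n1; have [n0|n0] := ltP n 0.
  by rewrite fv // lt_eqF // subrr.
have -> : n = 0 by apply: le_anti; rewrite n0 -ltzD1 n1.
by rewrite f0 eqxx subrr.
Qed.

Lemma unit_series_lpow f s : unit_series f -> unit_series (lpow f s).
Proof.
move=> uf; split; first exact: pseries_comp_vanishes.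
by rewrite /lpow pseries_comp0 /gbinomial big_ord0 fact0 divr1.
Qed.

(** Coefficient form of the equation (1 + u) y' = s y satisfied by the binomial series y = (1 +
    u)^s. *)
Lemma gbinomial_rec (s : C) k :
  k.+1%:R * gbinomial s k.+1 + k%:R * gbinomial s k = s * gbinomial s k.
Proof.
rewrite /gbinomial big_ord_recr /= factS natrM.
have k0 : k.+1%:R != 0 :> C by rewrite pnatr_eq0.
have f0 : k`!%:R != 0 :> C by rewrite pnatr_eq0 -lt0n fact_gt0.
by field; rewrite f0 nat1r ?k0.
Qed.

Lemma logtheta_lpow f s : unit_series f -> logtheta (lpow f s) = lconst s * logtheta f.
Proof.
move=> uf; have f0 := unit_series_neq0 uf; have u1 := unit_series_vanishes_sub1 uf.
have l0 := unit_series_neq0 (unit_series_lpow s uf).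
suff : f * ltheta (lpow f s) = lconst s * ltheta f * lpow f s.
  by move=> h; apply/eqP; rewrite /logtheta [X in _ == X]mulrA eqr_div // mulrC h.
rewrite {1}/lpow pseries_comp_theta // raddfB /= ltheta1 subr0.
(* Writing f as 1 + (f - 1) produces the two terms on the left of [gbinomial_rec]. *)
set a := fun k => _; have -> : f * (ltheta f * pseries_comp a (f - 1)) =
    ltheta f * (pseries_comp a (f - 1) + (f - 1) * pseries_comp a (f - 1)) by ring.
rewrite mul_pseries_comp // -pseries_compD.
rewrite (eq_pseries_comp _ (b := fun k => s * gbinomial s k)).
  by rewrite pseries_compZ -/(lpow f s); ring.
case=> [|k]; last by rewrite /a -gbinomial_rec.
by rewrite /a -gbinomial_rec mul0r.
Qed.

End LogDerivative.

(** * The closed formula of case (a) and its algebraicity *)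

Section ZetaFormulaProof.
Variable C : numFieldType.
Implicit Types (r : C) (N : nat -> C).

Lemma lmonoX r n : lmono r 1 ^+ n = lmono (r ^+ n) n%:Z.
Proof.
elim: n => [|n IH]; first by rewrite !expr0 lmono1.
by rewrite !exprS IH lmonoM -PoszD.
Qed.

(* Unqualified, [pseries] would be the one of MathComp-Analysis. *)
Definition geom_series r (L : nat) : laurent C :=
  Defs.pseries (fun k => if (0 < k)%N && (L %| k)%N then r ^+ k else 0).

(** The sum of (r z)^k over the positive multiples k of L is (r z)^L / (1 - (r z)^L), stated without
    division. *)
Lemma geom_series_mul r L : (0 < L)%N ->
  geom_series r L * (1 - lmono (r ^+ L) L%:Z) = lmono (r ^+ L) L%:Z.
Proof.
move=> L0; rewrite mulrBr mulr1 mulrC; apply: laurentP => n; rewrite lcoefD lcoefN lcoef_monoM.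
have [nL|Ln] := ltP n L%:Z.
  have -> : geom_series r L (n - L%:Z) = 0.
    by move: nL; rewrite -subr_lt0; case: (n - L%:Z).
  rewrite mulr0 subr0 /= lt_eqF //; case: n nL => // n nL /=.
  case: ifP => // /andP[n0 /dvdn_leq]; rewrite n0 => /(_ isT).
  by rewrite leqNgt -ltz_nat nL.
case: n Ln => // n Ln; rewrite lez_nat in Ln; rewrite subzn //= eqz_nat (leq_trans L0 Ln) /=.
rewrite subn_gt0 dvdn_subl //.
have [nL|nL|nL] := ssrnat.ltngtP L n; [|by rewrite ltnNge Ln in nL|]; last first.
  by rewrite nL dvdnn mulr0 subr0.
rewrite /=; case: ifP => _; rewrite ?mulr0 ?subr0 //.
by rewrite -exprD subnKC // subrr.
Qed.

Lemma unit_series_geom_denom r L : (0 < L)%N -> unit_series (1 - lmono (r ^+ L) L%:Z).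
Proof.
move=> L0; split=> [n n0|]; rewrite lcoefD lcoefN /=.
  by rewrite !lt_eqF ?subr0 // (lt_trans n0) // ltz_nat.
by rewrite eqz_nat eq_sym -leqn0 leqNgt L0 subr0.
Qed.

Lemma logtheta_geom_denom r L : (0 < L)%N ->
  logtheta (1 - lmono (r ^+ L) L%:Z) = - (lconst L%:R * geom_series r L).
Proof.
move=> L0; have f0 := unit_series_neq0 (unit_series_geom_denom r L0).
apply: (mulIf f0); rewrite /logtheta divfK // raddfB /= ltheta1 sub0r ltheta_mono.
by rewrite mulNr -mulrA geom_series_mul // lmonoM add0r.
Qed.

Section Sieve.
Variables (M : nat) (m : 'I_M -> nat) (r : C).
Hypothesis m_gt0 : forall i, (0 < m i)%N.

Lemma subset_lcm_gt0 (I : {set 'I_M}) : (0 < subset_lcm m I)%N.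
Proof.
rewrite /subset_lcm; elim/big_rec: _ => // i x _ x0.
by rewrite lcmn_gt0 m_gt0.
Qed.

(** Inclusion-exclusion: expand the product of the factors 1 - [m_i divides k]; all m_i with i in I
    divide k exactly when their lcm does. *)
Lemma sieve_coef k : \prod_i (if (m i %| k)%N then 0 else 1) =
  \sum_(I : {set 'I_M}) (-1) ^+ #|I| * (subset_lcm m I %| k)%N%:R :> C.
Proof.
have -> : \prod_i (if (m i %| k)%N then 0 else 1) =
    \prod_i (- (m i %| k)%N%:R + 1) :> C.
  by apply: eq_bigr => i _; case: ifP => _; rewrite ?addNr ?oppr0 ?add0r.
rewrite bigA_distr; apply: eq_bigr => I _.
rewrite -big_mkcond prodrN; congr (_ * _).
have [/dvdn_biglcmP mk|] := boolP (subset_lcm m I %| k)%N.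
  by rewrite big1 // => i /mk ->.
move=> mk; have [i iI mik] : exists2 i, i \in I & ~~ (m i %| k)%N.
  apply/exists_inP; apply: contraNT mk; rewrite negb_exists_in => /forall_inP mk.
  by apply/dvdn_biglcmP => i iI; apply/negPn; exact: mk.
by rewrite (bigD1 i) //= (negPf mik) mul0r.
Qed.

Lemma unit_series_zeta_formula : unit_series (zeta_formula m r).
Proof.
apply: unit_seriesM.
  apply: unit_seriesV; have := unit_series_geom_denom r (ltnSn 0).
  by rewrite expr1.
apply: unit_series_prod => l _; apply: unit_series_prod => I _.
by rewrite lmonoX; apply/unit_series_lpow/unit_series_geom_denom/subset_lcm_gt0.
Qed.

(** The logarithmic derivative of 1 - (r z)^L carries a factor - L, which the exponent (-1)^(l+1) /
    L reduces to the sign (-1)^l. The factor 1 / (1 - r z) supplies the term of the empty set, whose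
    lcm is 1. *)
Lemma logtheta_zeta_formula : logtheta (zeta_formula m r) =
  \sum_(I : {set 'I_M}) lconst ((-1) ^+ #|I|) * geom_series r (subset_lcm m I).
Proof.
have d1 : unit_series (1 - lmono r 1).
  by have := unit_series_geom_denom r (ltnSn 0); rewrite expr1.
have uL I s : unit_series (lpow (1 - lmono r 1 ^+ subset_lcm m I) s).
  by rewrite lmonoX; apply/unit_series_lpow/unit_series_geom_denom/subset_lcm_gt0.
have uP l P : unit_series (\prod_(I : {set 'I_M} | P I)
     lpow (1 - lmono r 1 ^+ subset_lcm m I) ((-1) ^+ l / (subset_lcm m I)%:R)).
  by apply: unit_series_prod.
rewrite /zeta_formula logthetaM ?invr_eq0 ?unit_series_neq0 //; last exact: unit_series_prod.
rewrite logthetaV ?unit_series_neq0 // logtheta_prod => [|l _]; last exact: unit_series_neq0.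
have -> : logtheta (1 - lmono r 1) = - geom_series r 1.
  by have := logtheta_geom_denom r (ltnSn 0); rewrite expr1 (rmorph1 (@lconst C)) mul1r.
rewrite opprK.
pose G (I : {set 'I_M}) := lconst ((-1) ^+ #|I|) * geom_series r (subset_lcm m I).
have GE (l : nat) : logtheta (\prod_(I : {set 'I_M} | #|I| == l)
     lpow (1 - lmono r 1 ^+ subset_lcm m I) ((-1) ^+ l.+1 / (subset_lcm m I)%:R)) =
    \sum_(I : {set 'I_M} | #|I| == l) G I.
  rewrite logtheta_prod => [|I _]; last exact: unit_series_neq0.
  apply: eq_bigr => I /eqP <-; have L0 := subset_lcm_gt0 I.
  rewrite lmonoX logtheta_lpow; last exact: unit_series_geom_denom.
  rewrite logtheta_geom_denom //.
  rewrite -mulNr -rmorphN mulrA -rmorphM /=; congr (lconst _ * _).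
  by rewrite mulrN divfK ?pnatr_eq0 -?lt0n // exprS mulN1r opprK.
rewrite (eq_bigr _ (fun l _ => GE l)).
have -> : geom_series r 1 = \sum_(I : {set 'I_M} | #|I| == 0%N) G I.
  rewrite (big_pred1 finset.set0) => [|I]; last by rewrite cards_eq0.
  by rewrite /G cards0 expr0 rmorph1 mul1r /subset_lcm big_set0.
rewrite -(big_ltn (F := fun l => \sum_(I : {set 'I_M} | #|I| == l) G I)) // big_mkord.
rewrite (exchange_big_dep xpredT) //=; apply: eq_bigr => I _.
have IM : (#|I| < M.+1)%N by rewrite ltnS -[M in (_ <= M)%N]card_ord max_card.
by rewrite (big_pred1 (Ordinal IM)) // => l; rewrite eq_sym.
Qed.

(** Both sides have constant term 1, so it suffices to compare logarithmic derivatives;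
    coefficientwise this is [sieve_coef]. *)
Lemma lexp_zeta_formula N :
  (forall k, (0 < k)%N -> N k = r ^+ k * \prod_i (if (m i %| k)%N then 0 else 1)) ->
  lexp (Defs.pseries (fun k => if k == 0%N then 0 else N k / k%:R)) = zeta_formula m r.
Proof.
move=> NE; set U := Defs.pseries _.
have U1 : vanishes_below U 1 by case=> [[]|].
apply: logtheta_inj; [exact: unit_series_lexp|exact: unit_series_zeta_formula|].
rewrite logtheta_lexp // logtheta_zeta_formula; apply: laurentP => n.
rewrite lcoef_theta lcoef_sum; under eq_bigr do rewrite lcoef_constM.
case: n => [[|k]|k]; rewrite /= ?mulr0 ?mul0r.
- by rewrite big1 // => I _; rewrite mulr0.
- rewrite mulrC -mulrA -[_ * k.+1%:~R]/(_ * k.+1%:R) mulVf ?pnatr_eq0 // mulr1.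
  rewrite NE // sieve_coef mulr_sumr; apply: eq_bigr => I _.
  by case: (subset_lcm m I %| k.+1)%N; rewrite ?mulr1 ?mulr0 // mulrC.
- by rewrite big1 // => I _; rewrite mulr0.
Qed.

End Sieve.

Lemma laurent_of_frac_tofrac (P : {poly C}) :
  laurent_of_frac (FracField.tofrac P) = poly_at (lX C) P.
Proof.
rewrite /laurent_of_frac; unlock FracField.tofrac.
set x := repr _; have := FracField.equivf_l (Ratio P 1); rewrite -/x.
rewrite !numden_Ratio ?oner_neq0 // mulr1 => ->; rewrite rmorphM /=.
rewrite mulrAC divff ?mul1r //.
by rewrite -(rmorph0 (poly_at (lX C))) (inj_eq (@poly_X_inj C)) denom_ratioP.
Qed.

Lemma lmono_of_frac c n : exists x : {fraction {poly C}}, laurent_of_frac x = lmono c n%:Z.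
Proof.
exists (FracField.tofrac (c *: 'X^n)); rewrite laurent_of_frac_tofrac.
apply: laurentP => -[] k; rewrite coef_poly_X //= coefZ coefXn eqz_nat.
by case: eqP; rewrite ?mulr1 ?mulr0.
Qed.

Lemma algebraic_root (x : laurent C) (y : {fraction {poly C}}) n : (0 < n)%N ->
  x ^+ n = laurent_of_frac y -> algebraic_function x.
Proof.
move=> n0 xn; exists ('X^n - y%:P); first by rewrite monic_neq0 ?monicXnsubC.
by rewrite rmorphB /= map_polyXn map_polyC /root !hornerE xn subrr //.
Qed.

(** Each binomial factor is an L-th root of f or 1/f, where f = 1 - (r z)^L is rational, and
    algebraic elements are closed under products and inverses. *)
Lemma algebraic_zeta_formula M (m : 'I_M -> nat) r : (forall i, (0 < m i)%N) ->
  algebraic_function (zeta_formula m r).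
Proof.
move=> m0.
have denom L : exists y : {fraction {poly C}}, laurent_of_frac y = 1 - lmono (r ^+ L) L%:Z.
  by have [y yE] := lmono_of_frac (r ^+ L) L; exists (1 - y); rewrite rmorphB rmorph1 /= yE.
apply: algebraic_mul.
  apply: algebraic_inv; have [y yE] := denom 1%N.
  by rewrite expr1 in yE; rewrite -yE; exact: algebraic_id.
elim/big_rec: _ => [|l x _ xA]; first exact: algebraic1.
apply: algebraic_mul xA; elim/big_rec: _ => [|I z _ zA]; first exact: algebraic1.
apply: algebraic_mul zA; have L0 := subset_lcm_gt0 m0 I; rewrite lmonoX.
move: (subset_lcm m I) L0 => L L0; have [y yE] := denom L.
have uf := unit_series_geom_denom r L0.
have f0 := unit_series_neq0 uf.
have up s := unit_series_lpow s uf.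
have powE s : lpow (1 - lmono (r ^+ L) L%:Z) (s / L%:R) ^+ L =
              lpow (1 - lmono (r ^+ L) L%:Z) s.
  apply: logtheta_inj; [exact: unit_seriesX|by []|].
  rewrite logthetaX ?unit_series_neq0 // !logtheta_lpow // -[LHS]mulr_natl mulrA.
  rewrite -(rmorph_nat (@lconst C) L) -rmorphM /= [L%:R * _]mulrC divfK //.
  by rewrite pnatr_eq0 -lt0n.
rewrite -signr_odd; case: (odd _).
  apply: (algebraic_root (y := y^-1) L0); rewrite powE fmorphV /= yE.
  apply: logtheta_inj; [by []|exact: unit_seriesV|].
  by rewrite logtheta_lpow // logthetaV // expr1 rmorphN1 mulN1r.
apply: (algebraic_root (y := y) L0); rewrite powE yE.
by apply: logtheta_inj => //; rewrite logtheta_lpow // expr0 rmorph1 mul1r.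
Qed.

End ZetaFormulaProof.

(** * D-finite series and recurrences *)

Section Recurrence.
Variable C : numFieldType.
Implicit Types (f g : laurent C).

Lemma common_denominator n (w : 'I_n -> {fraction {poly C}}) :
  exists (Q : {poly C}) (P : 'I_n -> {poly C}), Q != 0 /\
    forall i, poly_at (lX C) Q * laurent_of_frac (w i) = poly_at (lX C) (P i).
Proof.
pose d i := (frac (repr (w i))).2; pose N i := (frac (repr (w i))).1.
have d0 i : d i != 0 by exact: denom_ratioP.
exists (\prod_i d i), (fun i => N i * \prod_(j | j != i) d j); split.
  by apply/prodf_neq0 => i _.
move=> i; rewrite (bigD1 i) //= !rmorphM /= /laurent_of_frac -/(d i) -/(N i).
have : poly_at (lX C) (d i) != 0.
  by rewrite -(rmorph0 (poly_at (lX C))) (inj_eq (@poly_X_inj C)).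
by move=> ?; field.
Qed.

(** The first n + 1 derivatives lie in the span of n series, so some row vector kills their
    coefficient matrix; clearing denominators makes the relation polynomial. *)
Lemma D_finite_diffeq f : D_finite f ->
  exists n (P : 'I_n -> {poly C}), (exists i, P i != 0) /\
    \sum_(i < n) poly_at (lX C) (P i) * iter i (@lderiv C) f = 0.
Proof.
move=> [n [g /choice[c cE]]].
pose c' : 'M[{fraction {poly C}}]_(n.+1, n) := \matrix_(k, i) c k i.
have [w w0 wc] : exists2 w : 'rV_n.+1, w != 0 & w *m c' = 0.
  have : kermx c' != 0.
    rewrite -mxrank_eq0 mxrank_ker subn_eq0 -ltnNge.
    exact: leq_ltn_trans (rank_leq_col _) _.
  by move=> /rowV0Pn[w /sub_kermxP wc w0]; exists w.
have [Q [P [Q0 PE]]] := common_denominator (w 0).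
exists n.+1, P; split.
  apply: contrapT => P0; move/eqP: w0; apply; apply/matrixP => i k; rewrite ord1 mxE.
  apply/eqP/negPn/negP => wk; apply: P0; exists k.
  rewrite -(inj_eq (@poly_X_inj C)) rmorph0 -PE mulf_neq0 ?fmorph_eq0 //.
  by rewrite -(rmorph0 (poly_at (lX C))) (inj_eq (@poly_X_inj C)).
under eq_bigr do rewrite -PE -mulrA cE mulr_sumr.
rewrite -mulr_sumr exchange_big big1 ?mulr0 //= => i _.
under eq_bigr do rewrite mulrA -rmorphM.
rewrite -mulr_suml -rmorph_sum /=.
have -> : \sum_k w 0 k * c k i = (w *m c') 0 i.
  by rewrite mxE; apply: eq_bigr => k _; rewrite mxE.
by rewrite wc mxE rmorph0 mul0r.
Qed.

Lemma lcoef_iter_deriv f k (n : int) :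
  iter k (@lderiv C) f n = (\prod_(i < k) (n + i.+1%:Z)%:~R) * f (n + k%:Z).
Proof.
elim: k n => [|k IH] n; first by rewrite big_ord0 mul1r addr0.
rewrite iterS [LHS]/= IH big_ord_recl mulrA; congr (_ * _ * f _).
  by apply: eq_bigr => i _; rewrite /bump /= -addrA.
by rewrite -addrA.
Qed.

Lemma lcoef_poly_atM (P : {poly C}) f (n : int) B : (size P <= B)%N ->
  (poly_at (lX C) P * f) n = \sum_(b < B) P`_b * f (n - b%:Z).
Proof.
move=> PB; rewrite /poly_at (@horner_coef_wide _ B) ?size_map_poly //.
rewrite mulr_suml lcoef_sum; apply: eq_bigr => b _.
have -> : (map_poly (@lconst C) P)`_b = lmono P`_b 0 by rewrite coef_map.
by rewrite lX_exp lmonoM mulr1 add0r lcoef_monoM.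
Qed.

(** Each polynomial is evaluated at the index [m + s] of its own term, so that a recurrence can be
    centred at any of its terms by translating the other polynomials. *)
Definition P_recursive (a : nat -> C) : Prop :=
  exists (S : nat) (R : 'I_S -> {poly C}), (exists s, R s != 0) /\
    forall m, \sum_(s < S) (R s).[(m + s)%:R] * a (m + s)%N = 0.

(* Multiplying by z^B shifts the operator so that all its terms have
   nonnegative index shift k + B - b. *)
Lemma D_finite_P_recursive (a : nat -> C) :
  D_finite (Defs.pseries a) -> P_recursive a.
Proof.
move=> /D_finite_diffeq[n [P [[i0 Pi0] PE]]].
pose B := (\max_i size (P i))%N.
have PB i : (size (P i) <= B)%N by exact: leq_bigmax.
(* Falling factorials: [ff k] at the index of the original coefficient is the factor created by k
   derivations. *)
pose ff k : {poly C} := \prod_(i < k) ('X - i%:R%:P).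
have size_ff k : size (ff k) = k.+1.
  by rewrite /ff size_prod_XsubC /index_enum -enumT size_enum_ord.
pose R (s : 'I_(n + B)) : {poly C} :=
  \sum_(k < n) \sum_(b < B | (k + B - b)%N == s) (P k)`_b *: ff k.
exists (n + B)%N, R; split.
  (* Take k maximal with P_k nonzero, and b = deg P_k. In the matching [R s] the coefficient of X^k
     comes from [ff k] alone, as lower orders have smaller degree, and from b alone, as s and k
     determine b. *)
  have [k Pk kmax] : exists2 k, P k != 0 & forall k', P k' != 0 -> (k' <= k)%N.
    by case: (@arg_maxnP _ i0 (fun k => P k != 0) (fun k : 'I_n => k : nat) Pi0) => k; exists k.
  have b_lt : ((size (P k)).-1 < B)%N.
    by rewrite (leq_trans _ (PB k)) // prednK // size_poly_gt0.
  pose b := Ordinal b_lt.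
  have s_lt : (k + B - b < n + B)%N.
    by rewrite (leq_ltn_trans (leq_subr _ _)) // ltn_add2r.
  exists (Ordinal s_lt); apply/negP => /eqP /(congr1 (fun p : {poly C} => p`_k)).
  rewrite coef0 coef_sum (bigD1 k) //= coef_sum (bigD1 b) //= coefZ.
  have -> : (ff k)`_k = 1.
    have : ff k \is monic by exact: monic_prod_XsubC.
    by rewrite monicE lead_coefE size_ff => /eqP.
  rewrite mulr1 !big1 ?addr0; last 2 first.
  - move=> k' k'k; rewrite coef_sum big1 // => b' _; rewrite coefZ.
    have [Pk'|/kmax lek] := eqVneq (P k') 0; first by rewrite Pk' coef0 mul0r.
    by rewrite [(ff k')`_k]nth_default ?mulr0 // size_ff ltn_neqAle k'k.
  - move=> b' /andP[/eqP bb' b'b]; case/eqP: b'b; apply: val_inj => /=.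
    have := ltn_ord b'; rewrite -/(val b') /= in bb' *; lia.
  by apply/eqP; rewrite -lead_coefE lead_coef_eq0.
move=> m; have := congr1 (fun f : laurent C => f (m%:Z + B%:Z)) PE.
rewrite lcoef_sum lcoef0 => E0; apply: etrans E0.
rewrite [RHS](eq_bigr _ (fun k _ => lcoef_poly_atM _ _ (PB k))).
have RE s x : (R s).[x] =
    \sum_(k < n) \sum_(b < B | (k + B - b)%N == s) ((P k)`_b *: ff k).[x].
  by rewrite /R horner_sum; apply: eq_bigr => k _; rewrite horner_sum.
transitivity (\sum_(s < n + B) \sum_(k < n) (\sum_(b < B | (k + B - b)%N == s)
    ((P k)`_b *: ff k).[(m + s)%:R]) * a (m + s)%N).
  by apply: eq_bigr => s _; rewrite RE mulr_suml.
rewrite [LHS]exchange_big; apply: eq_bigr => k _ /=.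
transitivity (\sum_(s < n + B) \sum_(b < B | (k + B - b)%N == s)
    ((P k)`_b *: ff k).[(m + s)%:R] * a (m + s)%N).
  by apply: eq_bigr => s _; rewrite mulr_suml.
rewrite (exchange_big_dep xpredT) //=; apply: eq_bigr => b _.
have s_lt : (k + B - b < n + B)%N.
  by rewrite (leq_ltn_trans (leq_subr _ _)) // ltn_add2r.
rewrite (big_pred1 (Ordinal s_lt)) => [|s /=]; last by rewrite -val_eqE eq_sym.
rewrite hornerZ /= -mulrA; congr (_ * _); rewrite lcoef_iter_deriv.
have bB := ltnW (ltn_ord b).
have -> : m%:Z + B%:Z - b%:Z + k%:Z = (m + (k + B - b))%N%:Z by lia.
congr (_ * _); rewrite horner_prod (reindex_inj rev_ord_inj) /=.
apply: eq_bigr => i _; rewrite hornerXsubC -natrB; last by have := ltn_ord i; lia.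
rewrite [LHS]pmulrn; congr (_%:~R).
have := ltn_ord i; lia.
Qed.

End Recurrence.

(** * Derivations on the field generated by an algebraic element *)

Section DifferentialAdjunction.
Variables (k E : fieldType) (phi : {rmorphism k -> E}) (D : E -> E).
Hypothesis k_char0 : forall n, n.+1%:R != 0 :> k.
Hypothesis DD : forall x y, D (x + y) = D x + D y.
Hypothesis DM : forall x y, D (x * y) = D x * y + x * D y.
Hypothesis DK : forall c, exists c', D (phi c) = phi c'.
Implicit Types (f g : E).

Lemma derivation0 : D 0 = 0.
Proof. by apply: (addrI (D 0)); rewrite -DD !addr0. Qed.

Variable w : E.
Hypothesis w_alg : algebraicOver phi w.

Local Notation "q .{w}" := ((map_poly phi q).[w]) (at level 2, format "q .{w}").

Definition in_adjunction f : Prop := exists q : {poly k}, f = q.{w}.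

Lemma minimal_annihilator : exists P : {poly k}, [/\ P != 0, P.{w} = 0 &
  forall q : {poly k}, q != 0 -> (size q < size P)%N -> q.{w} != 0].
Proof.
have [P P0 /rootP Pw] := w_alg.
have : exists n, `[< exists P : {poly k}, [/\ P != 0, P.{w} = 0 & size P = n] >].
  by exists (size P); apply/asboolP; exists P.
case/ex_minnP => n /asboolP[P' [P'0 P'w <-]] nmin.
exists P'; split=> // q q0; rewrite ltnNge; apply: contraNN => /eqP qw.
by apply: nmin; apply/asboolP; exists q.
Qed.

Lemma adjunctionD f g : in_adjunction f -> in_adjunction g -> in_adjunction (f + g).
Proof. by move=> [q ->] [s ->]; exists (q + s); rewrite rmorphD hornerD. Qed.

Lemma adjunctionM f g : in_adjunction f -> in_adjunction g -> in_adjunction (f * g).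
Proof. by move=> [q ->] [s ->]; exists (q * s); rewrite rmorphM hornerM. Qed.

Lemma adjunction_frac c : in_adjunction (phi c).
Proof. by exists c%:P; rewrite map_polyC hornerC. Qed.

Lemma adjunction_gen : in_adjunction w.
Proof. by exists 'X; rewrite map_polyX hornerX. Qed.

(** The minimal annihilator P is coprime to q when q(w) is nonzero: a proper cofactor of gcd(P, q)
    in P does not vanish at w, so the gcd would, and q with it. A Bézout relation evaluated at w
    gives the inverse. *)
Lemma adjunctionV f : in_adjunction f -> in_adjunction f^-1.
Proof.
move=> [q ->]; have [->|qw0] := eqVneq q.{w} 0.
  by rewrite invr0 -(rmorph0 phi); exact: adjunction_frac.
have [P [P0 Pw Pmin]] := minimal_annihilator.
have cop : coprimep P q.
  rewrite /coprimep; apply: contraNT qw0 => sg.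
  have g0 : gcdp P q != 0 by rewrite gcdp_eq0 (negPf P0).
  have /dvdpP[h hE] := dvdp_gcdl P q; have /dvdpP[l lE] := dvdp_gcdr P q.
  have gw : (gcdp P q).{w} = 0.
    have h0 : h != 0 by apply: contraNneq P0 => h0; rewrite hE h0 mul0r.
    have /negPf hw0 : h.{w} != 0.
      apply: Pmin => //; rewrite hE size_mul //.
      move: sg g0 h0; rewrite -!size_poly_gt0.
      move: (size h) (size (gcdp P q)) => b [|[|a]] // _ _ _.
      by rewrite addnS /= -[X in (X < _)%N]addn0 ltn_add2l.
    have /eqP : (h * gcdp P q).{w} = 0 by rewrite -hE.
    by rewrite rmorphM hornerM mulf_eq0 hw0 => /eqP.
  by rewrite lE rmorphM hornerM gw mulr0.
have [[u v] /= uv] := Bezout_coprimepP _ _ cop.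
have /size_poly1P[c c0 cE] : size (u * P + v * q) == 1%N by rewrite (eqp_size uv) size_poly1.
exists (c^-1 *: v); rewrite linearZ_LR /= hornerZ.
have : phi c = v.{w} * q.{w}.
  have := congr1 (fun s : {poly k} => s.{w}) cE.
  by rewrite rmorphD !rmorphM hornerD !hornerM Pw mulr0 add0r map_polyC hornerC => ->.
move=> cvq; apply: (mulIf qw0); rewrite mulVf // -mulrA -cvq fmorphV mulVf //.
by rewrite fmorph_eq0.
Qed.

(** The polynomial s arises by applying the derivation to the coefficients of q. *)
Lemma deriv_horner (q : {poly k}) :
  exists s, D q.{w} = s.{w} + (q^`()).{w} * D w.
Proof.
elim/poly_ind: q => [|q c [s sE]].
  exists 0; rewrite deriv0 !rmorph0 horner0 mul0r add0r.
  by rewrite derivation0.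
have [c' cE] := DK c; exists (s * 'X + c'%:P).
rewrite derivD derivC addr0 derivM derivX mulr1.
rewrite !rmorphD !rmorphM /= !map_polyX !map_polyC /= !hornerE.
by rewrite DD DM sE cE; ring.
Qed.

(** Differentiating P(w) = 0 expresses P'(w) D w through a polynomial in w, and P'(w) is nonzero by
    minimality of P and characteristic 0. *)
Lemma adjunction_deriv f : in_adjunction f -> in_adjunction (D f).
Proof.
suff Dw : in_adjunction (D w).
  move=> [q ->]; have [s ->] := deriv_horner q.
  by apply: adjunctionD; [exists s|apply: adjunctionM Dw; exists q^`()].
have [P [P0 Pw Pmin]] := minimal_annihilator.
have sP : (1 < size P)%N.
  rewrite ltnNge; apply/negP => /size1_polyC PE; move/eqP: Pw.
  by rewrite PE map_polyC hornerC fmorph_eq0 -polyC_eq0 -PE (negPf P0).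
have P'0 : P^`() != 0.
  apply/eqP => /(congr1 (fun p : {poly k} => p`_(size P).-2)); rewrite coef_deriv coef0.
  have -> : (size P).-2.+1 = (size P).-1 by move: sP; case: size => // -[].
  rewrite -lead_coefE -mulr_natr => /eqP; rewrite mulf_eq0 lead_coef_eq0 (negPf P0) /=.
  by rewrite -[(size P).-1](@prednK) ?(negPf (k_char0 _)) // -subn1 subn_gt0.
have P'w : (P^`()).{w} != 0 by apply: Pmin => //; exact: lt_size_deriv.
have [s] := deriv_horner P; rewrite Pw.
rewrite derivation0 => /esym/eqP; rewrite addrC addr_eq0 => /eqP sE.
have -> : D w = (phi (-1) * s.{w}) * ((P^`()).{w})^-1.
  by apply: (mulfI P'w); rewrite sE rmorphN1 mulN1r mulrC divfK.
apply: adjunctionM; first by apply: adjunctionM; [exact: adjunction_frac|exists s].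
by apply: adjunctionV; exists P^`().
Qed.

Lemma adjunction_span : exists n, forall f, in_adjunction f ->
  exists c : 'I_n -> k, f = \sum_(i < n) phi (c i) * w ^+ i.
Proof.
have [P [P0 Pw Pmin]] := minimal_annihilator.
exists (size P) => f [q ->]; exists (fun i => (q %% P)`_i).
rewrite {1}(divp_eq q P) rmorphD rmorphM hornerD hornerM Pw mulr0 add0r.
rewrite (@horner_coef_wide _ (size P)) ?size_map_poly; last by rewrite ltnW // ltn_modp.
by apply: eq_bigr => i _; rewrite coef_map.
Qed.

End DifferentialAdjunction.

Section AlgebraicDFinite.
Variable C : numFieldType.
Implicit Types (f g : laurent C).
Local Notation K := {fraction {poly C}}.
Local Notation lof := (@laurent_of_frac C).
Local Notation D := (@lderiv C).

Lemma lderivM f g : D (f * g) = D f * g + f * D g.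
Proof. by rewrite !lderiv_theta lthetaM; ring. Qed.

Lemma lderivD f g : D (f + g) = D f + D g.
Proof. by rewrite !lderiv_theta raddfD mulrDr. Qed.

Lemma lderiv_poly (P : {poly C}) : D (poly_at (lX C) P) = poly_at (lX C) P^`().
Proof.
apply: laurentP => n; rewrite [LHS]/= !coef_poly_X.
have [n0|n0] := leP 0 n; first case: n n0 => // n _.
  by rewrite -[n%:Z + 1]/((n + 1)%N%:Z) addn1 coef_deriv mulrC -[_.+1%:~R]/(_.+1%:R) mulr_natr.
have [->|n1] := eqVneq (n + 1) 0; first by rewrite mul0r; case: n n0.
have : n + 1 < 0 by rewrite lt_neqAle n1 lezD1.
by case: (n + 1) => // k _; rewrite mulr0; case: n n0 {n1}.
Qed.

(** The quotient rule, obtained by differentiating Q c = P. *)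
Lemma lderiv_frac (c : K) : exists c', D (lof c) = lof c'.
Proof.
have [Q [P [Q0 /(_ ord0)]]] := common_denominator (fun _ : 'I_1 => c).
rewrite -!laurent_of_frac_tofrac -rmorphM => /(congr1 D).
rewrite rmorphM lderivM /= !laurent_of_frac_tofrac !lderiv_poly -!laurent_of_frac_tofrac.
set q := FracField.tofrac Q; set q' := FracField.tofrac _; set p' := FracField.tofrac _ => E.
exists ((p' - q' * c) / q).
have q0 : lof q != 0 by rewrite fmorph_eq0 tofrac_eq0.
by apply: (mulfI q0); rewrite fmorph_div [RHS]mulrC divfK // rmorphB rmorphM /= -E addrC addKr.
Qed.

Lemma algebraic_logtheta_D_finite (w : laurent C) : algebraic_function w -> D_finite (logtheta w).
Proof.
move=> w_alg; have [n span] := adjunction_span w_alg.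
exists n, (fun i => w ^+ i) => k; apply: span.
have char0 m : m.+1%:R != 0 :> K.
  by rewrite -(fmorph_eq0 lof) rmorph_nat -(rmorph_nat (@lconst C)) fmorph_eq0 pnatr_eq0.
elim: k => [|k IH]; last exact: (adjunction_deriv char0 lderivD lderivM lderiv_frac).
have [x xE] := lmono_of_frac (1 : C) 1.
have -> : logtheta w = lof x * D w * w^-1.
  by rewrite /logtheta lderiv_theta mulrA xE lmonoM mulr1 subrr lmono1 mul1r.
have wE := adjunction_gen lof w.
apply: adjunctionM; last exact: adjunctionV.
apply: adjunctionM; first exact: adjunction_frac.
exact: (adjunction_deriv char0 lderivD lderivM lderiv_frac).
Qed.

End AlgebraicDFinite.

(** * Sequences whose dependence on the p-part of the index excludes a recurrence *)

Section NotRecursive.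
Variable C : numFieldType.

Lemma poly_eq0_infinite (P : {poly C}) (k : nat -> nat) : injective k ->
  (forall t, P.[(k t)%:R] = 0) -> P = 0.
Proof.
move=> kI kP; apply: (@roots_geq_poly_eq0 _ _ [seq (k t)%:R | t <- iota 0 (size P)]).
- by apply/allP => x /mapP[t _ ->]; apply/eqP.
- by rewrite map_inj_uniq ?iota_uniq // => s t /eqP; rewrite eqr_nat => /eqP /kI.
- by rewrite size_map size_iota.
Qed.

Variables (p Q : nat).
Hypotheses (p_prime : prime p) (Q_gt0 : (0 < Q)%N) (pQ : coprime p Q).

Lemma partn_eq_pfactor x v : (0 < x)%N -> (p ^ v %| x)%N -> ~~ (p ^ v.+1 %| x)%N ->
  (x`_p = p ^ v)%N.
Proof.
move=> x0; rewrite p_part !pfactor_dvdn // -ltnNge ltnS => vx xv.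
by congr (_ ^ _)%N; apply/eqP; rewrite eqn_leq vx xv.
Qed.

(** The p-adic valuation of d is smaller than e, hence than that of k, so adding or subtracting k
    does not affect it. *)
Lemma partn_near_multiple e k d i : (p ^ e %| k)%N -> (0 < d < p ^ e)%N -> (0 < i)%N ->
  i = (k + d)%N \/ k = (i + d)%N -> (i`_p = d`_p)%N.
Proof.
move=> ek /andP[d0 de] i0 ikd; rewrite [RHS]p_part.
have ve : (logn p d < e)%N.
  rewrite -(ltn_exp2l _ _ (prime_gt1 p_prime)) (leq_ltn_trans _ de) //.
  by rewrite dvdn_leq ?pfactor_dvdnn.
have vk : (p ^ (logn p d).+1 %| k)%N by rewrite (dvdn_trans _ ek) // dvdn_exp2l.
have vk' : (p ^ logn p d %| k)%N by rewrite (dvdn_trans _ ek) // dvdn_exp2l // ltnW.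
have dv : ~~ (p ^ (logn p d).+1 %| d)%N by rewrite pfactor_dvdn // ltnn.
apply: partn_eq_pfactor => //; case: ikd => kE.
- by rewrite kE dvdn_addr // pfactor_dvdnn.
- by move: vk'; rewrite kE dvdn_addl // pfactor_dvdnn.
- by rewrite kE dvdn_addr.
- by apply: contra dv => iv; move: vk; rewrite kE dvdn_addr.
Qed.

(** Chinese remainders: being rho modulo Q is compatible with being p^e modulo p^(e+1), and the
    latter forces the p-part p^e. *)
Lemma sequence_mod_partn rho e : exists k : nat -> nat,
  [/\ injective k, forall t, (t <= k t)%N, forall t, k t = rho %[mod Q],
      forall t, ((k t)`_p = p ^ e)%N & forall t, (p ^ e %| k t)%N].
Proof.
have p0 := prime_gt0 p_prime.
have co : coprime Q (p ^ e.+1) by rewrite coprime_sym coprimeXl.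
pose x := chinese Q (p ^ e.+1) rho (p ^ e).
have m0 : (0 < Q * p ^ e.+1)%N by rewrite muln_gt0 Q_gt0 expn_gt0 p0.
pose k t := (x + t.+1 * (Q * p ^ e.+1))%N.
have kQ t : k t = rho %[mod Q].
  by rewrite /k mulnCA -modnDmr modnMr addn0 chinese_modl.
have kp t : k t = p ^ e %[mod p ^ e.+1].
  by rewrite /k mulnA -modnDmr modnMl addn0 chinese_modr.
have kpe t : (p ^ e %| k t)%N.
  have : (p ^ e %| k t %% p ^ e.+1)%N.
    by rewrite kp modn_small ?ltn_exp2l ?prime_gt1.
  by rewrite /dvdn modn_dvdm // dvdn_exp2l.
have tk t : (t < k t)%N.
  by rewrite /k (leq_trans _ (leq_addl _ _)) // leq_pmulr.
exists k; split=> //.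
- by move=> s t /addnI/eqP; rewrite eqn_pmul2r // => /eqP [].
- by move=> t; exact: ltnW.
- move=> t; apply: partn_eq_pfactor => //; first exact: leq_ltn_trans (tk t).
  rewrite /dvdn kp modn_small ?ltn_exp2l ?prime_gt1 //.
  by rewrite -lt0n expn_gt0 p0.
Qed.

Lemma not_P_recursive (r : C) (a : nat -> C) (phi : nat -> nat -> C) rho :
  r != 0 ->
  (forall k, (0 < k)%N -> a k = r ^+ k * phi (k %% Q)%N (k`_p)%N) ->
  (forall e e', phi (rho %% Q)%N (p ^ e)%N = phi (rho %% Q)%N (p ^ e')%N -> e = e') ->
  ~ P_recursive a.
Proof.
move=> r0 aE phiI [S [R [[s0 Rs0] RE]]].
pose d (s : 'I_S) := (if (s < s0)%N then s0 - s else s - s0)%N.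
(* Adding [Q * S] keeps the subtraction of s0 from truncating and does not change the class modulo
   Q. *)
pose b (s : 'I_S) := phi ((rho + Q * S - s0 + s) %% Q)%N ((d s)`_p)%N.
(* The recurrence centred at n, divided by r^(n - s0) and deprived of its term s0, as a polynomial
   in n; it does not involve e. *)
pose H := \sum_(s < S | s != s0) (r ^+ s * b s) *: (R s \Po ('X + (s%:R - s0%:R)%:P)).
(* For e >= S every shift is smaller than p^e, so the relation holds at infinitely many n and is an
   identity of polynomials. *)
have key e : (S <= e)%N -> H + (r ^+ s0 * phi (rho %% Q)%N (p ^ e)%N) *: R s0 = 0.
  move=> Se; have [k [kI kt kQ kp kpe]] := sequence_mod_partn rho e.
  have Spe : (S < p ^ e)%N by rewrite (leq_ltn_trans Se) // ltn_expl // prime_gt1.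
  apply: (@poly_eq0_infinite _ (fun t => k (t + S.+1)%N)) => [s t /kI /addIn//|t].
  set n := k _; have Sn : (S < n)%N by apply: leq_trans (kt _); rewrite leq_addl.
  have s0n : (s0 <= n)%N by apply: leq_trans (ltnW Sn); apply: ltnW.
  have /eqP := RE (n - s0)%N; rewrite (bigD1 s0) //= subnK // aE ?(leq_ltn_trans _ Sn) //.
  rewrite kQ kp; have -> : r ^+ n = r ^+ (n - s0) * r ^+ s0 by rewrite -exprD subnK.
  have term (s : 'I_S) : s != s0 -> (R s).[(n - s0 + s)%N%:R] * a (n - s0 + s)%N =
      r ^+ (n - s0) * ((r ^+ s * b s) *: (R s \Po ('X + (s%:R - s0%:R)%:P))).[n%:R].
    move=> ss0; have i0 : (0 < n - s0 + s)%N.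
      by rewrite ltn_addr // subn_gt0 (leq_trans _ (ltnW Sn)).
    rewrite aE // hornerZ horner_comp hornerD hornerX hornerC.
    have -> : (n - s0 + s)%:R = n%:R + (s%:R - s0%:R) :> C.
      by rewrite natrD natrB // addrA addrAC.
    have -> : ((n - s0 + s)`_p = (d s)`_p)%N.
      apply: (partn_near_multiple (kpe (t + S.+1)%N)) => //.
        have := ltn_ord s; have := ltn_ord s0; rewrite /d.
        move: ss0; rewrite -val_eqE /=; case: ifP; lia.
      rewrite -/n /d; case: ifP => h; [right|left]; lia.
    have -> : ((n - s0 + s) %% Q = (rho + Q * S - s0 + s) %% Q)%N.
      have QS : (s0 <= Q * S)%N.
        by rewrite (leq_trans (ltnW (ltn_ord s0))) // leq_pmull.
      apply/eqP; rewrite eqn_modDr -(eqn_modDr s0) !subnK //; last first.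
        exact: leq_trans (leq_addl _ _).
      by rewrite kQ -modnDmr modnMr addn0.
    by rewrite exprD -/(b s); ring.
  rewrite (eq_bigr _ term) -mulr_sumr.
  rewrite [X in X + _](_ : _ = r ^+ (n - s0) *
     ((r ^+ s0 * phi (rho %% Q)%N (p ^ e)%N) *: R s0).[n%:R]); last first.
    by rewrite hornerZ; ring.
  rewrite -mulrDr mulf_eq0 expf_eq0 (negPf r0) andbF /= => /eqP <-.
  by rewrite hornerD addrC horner_sum.
(* Subtracting the identities for e = S and e = S + 1 cancels [H]; as R_s0 is nonzero, two values of
   [phi] must coincide. *)
have := key S.+1 (leqnSn S); rewrite -(key S (leqnn S)) => /addrI /eqP.
rewrite -subr_eq0 -scalerBl scaler_eq0 (negPf Rs0) orbF -mulrBr mulf_eq0 expf_eq0.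
rewrite (negPf r0) andbF /= subr_eq0 => /eqP /phiI /eqP.
by rewrite eqn_leq ltnn.
Qed.

End NotRecursive.

(** * Convergence of complex power series *)

Section ComplexPowerSeries.
Variable R : realType.
Local Notation C := [the numClosedFieldType of R[i]].

Lemma normc_ge_Im (x : R[i]) : `|complex.Im x|%:C <= `|x|.
Proof. by case: x => a b; rewrite normc_def lecR -sqrtr_sqr ler_wsqrtr // lerDr sqr_ge0. Qed.

Lemma cvg_real_complex (x : nat -> R) : cvgn x -> cvgn (fun n => (x n)%:C : C).
Proof.
move=> /cvg_ex[l xl]; apply/cvg_ex; exists (l%:C : C).
apply/cvgrPdist_lt => -[e e'] /=; rewrite ltcE /= => /andP[/eqP -> e0].
have /cvgrPdist_lt/(_ _ e0) := xl; apply: filterS => n le.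
rewrite -rmorphB normc_def /= expr0n addr0 sqrtr_sqr ltcE /= eqxx /=.
by [].
Qed.

Lemma cvg_geometric_bound (u : nat -> R) (rho : R) : 0 <= rho < 1 ->
  (forall k, (0 < k)%N -> `|u k| <= rho ^+ k) ->
  cvgn (fun N => \sum_(1 <= k < N) u k).
Proof.
move=> /andP[rho0 rho1] ub; pose v k := if k == 0%N then 0 else u k.
have -> : (fun N => \sum_(1 <= k < N) u k) = series v.
  apply/funext => -[|N]; rewrite /series /=; first by rewrite !big_geq.
  rewrite [RHS]big_ltn // add0r; apply: eq_big_nat => k /andP[k0 _].
  by rewrite /v gtn_eqF.
apply: normed_cvg; apply: (@series_le_cvg _ _ (geometric 1 rho)).
- by move=> k; exact: normr_ge0.
- by move=> k; rewrite /geometric /= mul1r exprn_ge0.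
- move=> k; rewrite /geometric /= mul1r /v; case: eqP => [->|/eqP k0].
    by rewrite normr0 expr0 ler01.
  by rewrite ub // lt0n.
- by apply: is_cvg_geometric_series; rewrite ger0_norm.
Qed.

(** The real and imaginary parts are each dominated by the geometric series of ratio r |z| < 1. *)
Lemma cvg_complex_power_series (a : nat -> nat) (r : R) (z : C) : 0 < r ->
  (forall k, (0 < k)%N -> (a k)%:R <= r ^+ k) -> `|z| < (1 / r)%:C ->
  cvgn (fun N : nat => \sum_(1 <= k < N) (a k)%:R * z ^+ k : C).
Proof.
move=> r0 ar zr; pose t := Num.sqrt (complex.Re z ^+ 2 + complex.Im z ^+ 2).
have zt : `|z| = t%:C by exact: normc_def.
have tr : 0 <= r * t < 1.
  rewrite mulr_ge0 ?sqrtr_ge0 ?(ltW r0) //=.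
  by move: zr; rewrite zt ltcR ltr_pdivlMr // mulrC.
have bound (x : R) k : (0 < k)%N -> `|x|%:C <= `|z ^+ k| -> `|(a k)%:R * x| <= (r * t) ^+ k.
  move=> k0; rewrite normrX zt -rmorphXn lecR => xk.
  rewrite normrM normr_nat exprMn; apply: ler_pM => //; exact: ar.
have cRe := cvg_geometric_bound tr (fun k k0 => bound _ k k0 (normc_ge_Re (z ^+ k))).
have cIm := cvg_geometric_bound tr (fun k k0 => bound _ k k0 (normc_ge_Im (z ^+ k))).
have -> : (fun N : nat => \sum_(1 <= k < N) (a k)%:R * z ^+ k : C) =
    (fun N => (\sum_(1 <= k < N) (a k)%:R * complex.Re (z ^+ k))%:C) \+
    (fun N => 'i%C * (\sum_(1 <= k < N) (a k)%:R * complex.Im (z ^+ k))%:C).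
  apply/funext => N /=; rewrite !rmorph_sum mulr_sumr -big_split; apply: eq_bigr => k _ /=.
  by rewrite [z ^+ k in LHS]complexE mulrDr !rmorphM /= !rmorph_nat mulrCA.
apply: is_cvgD; first exact: cvg_real_complex.
by apply: is_cvgMl_tmp; exact: cvg_real_complex.
Qed.

End ComplexPowerSeries.

(** * Assembly of the two cases *)

Lemma dvdn_modn_dvd Q d k : (d %| Q)%N -> (d %| k %% Q)%N = (d %| k)%N.
Proof. by move=> dQ; rewrite {2}(divn_eq k Q) dvdn_addr // dvdn_mull. Qed.

(** This identity carries algebraicity of the zeta function over to D-finiteness of the series of
    the N_k. *)
Lemma artin_mazur_zeta_logtheta (T : topologicalType) (f : T -> T) (C : numFieldType) :
  logtheta (artin_mazur_zeta f C) = fixed_point_series f C.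
Proof.
rewrite logtheta_lexp; last by case=> [[]|].
apply: laurentP => -[[|k]|k]; rewrite lcoef_theta /= ?mulr0 //.
by rewrite -[_%:~R]/(k.+1%:R) mulrC divfK // pnatr_eq0.
Qed.

Theorem theorem1p6 (R : realType) (F : finFieldType)
    (L : closedFieldType) (iota : {rmorphism RF F -> L}) (absL : L -> R)
    (closL : is_algebraic_closure iota) (extL : is_abs_extension iota absL)
    (d : nat) (d_gt0 : (1 <= d)%N) (A : 'M[{poly F}]_d)
    (ev : seq L)
    (evP : map_poly (iota \o @polyt F) (char_poly A) =
           \prod_(x <- ev) ('X - x%:P))
    (mu eta : seq L)
    (muP : perm_eq mu [seq x <- ev | `[< is_root_of_unity x >]])
    (etaP : perm_eq eta
       [seq x <- ev | (absL x == 1) && ~~ `[< is_root_of_unity x >]])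
    (m : 'I_(size mu) -> nat) (n : 'I_(size eta) -> nat)
    (mP : forall i : 'I_(size mu), has_order_mod iota absL mu`_i (m i))
    (nP : forall j : 'I_(size eta), has_order_mod iota absL eta`_j (n j)) :
  let C : numClosedFieldType := R[i] in
  let f := @torus_act F d A in
  let r := spectral_r absL ev in
  [/\ forall k, (1 <= k)%N -> finite_set (isolated_fixed_points f k),
      (forall j, exists i, (m i %| n j)%N) ->
        algebraic_function (artin_mazur_zeta f C) /\
        artin_mazur_zeta f C = zeta_formula m (r%:C : C)
    & (exists j, forall i, ~~ (m i %| n j)%N) ->
        [/\ forall z : C, `|z| < (1 / r)%:C ->
              cvgn (fun N : nat => \sum_(1 <= k < N)
                (num_isolated_fixed_points f k)%:R * z ^+ k : C),
            ~ D_finite (fixed_point_series f C)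
          & ~ algebraic_function (artin_mazur_zeta f C)]].

Proof.
case: d d_gt0 A evP => // d _ A evP C f r.
have [p p_prime pF] := finPcharP F.
have m0 i : (0 < m i)%N by have /andP[] := has_order_mod_coprime pF (mP i).
have n0 j : (0 < n j)%N by have /andP[] := has_order_mod_coprime pF (nP j).
pose c (j : 'I_(size eta)) := absL (eta`_j ^+ n j - 1).
have c01 j : 0 < c j < 1 by exact: (residue_defect_bounds extL pF etaP (nP j)).
pose mu_part k : R := \prod_i (if (m i %| k)%N then 0 else 1).
pose eta_part k y : R := \prod_j (if (n j %| k)%N then c j ^+ y else 1).
have aE k : (0 < k)%N -> (num_isolated_fixed_points f k)%:R =
    r ^+ k * mu_part k * eta_part k (k`_p)%N.
  by move=> k0; exact: (num_isolated_fixed_points_formula extL pF evP muP etaP mP nP k0).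
have r0 : 0 < r by rewrite /r /spectral_r; apply: prodr_gt0 => x _; rewrite lt_max ltr01.
have aC k x : (num_isolated_fixed_points f k)%:R = x :> R ->
    (num_isolated_fixed_points f k)%:R = x%:C :> C.
  by move=> <-; rewrite rmorph_nat.
split=> [k k0||].
- exact: finite_isolated_fixed_points_torus.
- move=> mn; suff zE : artin_mazur_zeta f C = zeta_formula m (r%:C : C).
    by split=> //; rewrite zE; exact: algebraic_zeta_formula.
  apply: lexp_zeta_formula => // k k0.
  rewrite (aC _ _ (aE _ k0)) -rmorphXn.
  have -> : \prod_i (if (m i %| k)%N then 0 else 1) = (mu_part k)%:C :> C.
    by rewrite rmorph_prod; apply: eq_bigr => i _; case: ifP => _; rewrite ?rmorph0 ?rmorph1.
  rewrite -rmorphM; congr (_%:C).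
  (* If some m_i divides k, both sides vanish. Otherwise no n_j divides k, since each n_j is a
     multiple of some m_i, and the eta part is 1. *)
  have [/existsP[i mik]|nomik] := boolP [exists i, (m i %| k)%N].
    by rewrite /mu_part (bigD1 i) //= mik mul0r mulr0 mul0r.
  rewrite /eta_part big1 ?mulr1 // => j _; case: ifP => // njk.
  have [i mij] := mn j; case/negP: nomik; apply/existsP; exists i.
  exact: dvdn_trans njk.
- move=> [j0 mn].
  have notD : ~ D_finite (fixed_point_series f C).
    move=> /D_finite_P_recursive.
    (* A common period of all the divisibility conditions, prime to p because every order is. *)
    pose Q := (\prod_i m i * \prod_j n j)%N.
    have mQ i : (m i %| Q)%N by rewrite dvdn_mulr // (bigD1 i) //= dvdn_mulr.
    have nQ j : (n j %| Q)%N by rewrite dvdn_mull // (bigD1 j) //= dvdn_mulr.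
    have pQ : coprime p Q.
      rewrite coprimeMr; apply/andP; split.
        elim/big_rec: _ => [|i x _ px]; first by rewrite coprimen1.
        rewrite coprimeMr px andbT prime_coprime //.
        by have /andP[] := has_order_mod_coprime pF (mP i).
      elim/big_rec: _ => [|j x _ px]; first by rewrite coprimen1.
      rewrite coprimeMr px andbT prime_coprime //.
      by have /andP[] := has_order_mod_coprime pF (nP j).
    have Q0 : (0 < Q)%N by rewrite muln_gt0 !prodn_gt0.
    pose phi k y : C := (mu_part k * eta_part k y)%:C.
    (* In the class of n_j0 modulo Q no m_i divides the index, so the mu part is 1, whereas n_j0
       does divide it. *)
    apply: (not_P_recursive p_prime Q0 pQ (r := (r%:C : C)) (phi := phi) (rho := n j0)).
    + by rewrite -(rmorph0 (real_complex R)) (inj_eq (@complexI R)) gt_eqF.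
    + case=> // k _ /=; rewrite (aC _ _ (aE k.+1 isT)) -rmorphXn -rmorphM mulrA.
      congr (_ * _ * _)%:C.
        by apply: eq_bigr => i _; rewrite dvdn_modn_dvd.
      by apply: eq_bigr => j _; rewrite dvdn_modn_dvd.
    + move=> e e' /complexI.
      have -> : mu_part (n j0 %% Q)%N = 1.
        by rewrite /mu_part big1 // => i _; rewrite dvdn_modn_dvd // (negPf (mn i)).
      (* On this class the eta part is gamma^(k_p). Its factor c_j0 gives 0 < gamma < 1, so distinct
         p-parts give distinct values. *)
      pose gamma := \prod_j (if (n j %| n j0)%N then c j else 1).
      have gE y : eta_part (n j0 %% Q)%N y = gamma ^+ y.
        rewrite /gamma -prodrXl; apply: eq_bigr => j _.
        by rewrite dvdn_modn_dvd //; case: ifP => _; rewrite ?expr1n.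
      have g0 : 0 < gamma.
        by apply: prodr_gt0 => j _; case: ifP => // _; have /andP[] := c01 j.
      have g1 : gamma < 1.
        rewrite /gamma (bigD1 j0) //= dvdnn; have /andP[cj0 cj1] := c01 j0.
        apply: le_lt_trans cj1; rewrite ler_piMr ?(ltW cj0) //.
        apply: prodr_ile1 => j _; case: ifP => _; rewrite ?lexx ?ler01 //.
        by have /andP[/ltW -> /ltW] := c01 j.
      rewrite !mul1r !gE => /(ieexprIn g0 (negbT (lt_eqF g1))).
      exact/expnI/prime_gt1.
  split=> [z zr||] //.
    (* Both periodic factors lie between 0 and 1, whence N_k <= r^k. *)
    apply: cvg_complex_power_series (r0) _ zr => k k0; rewrite aE // -mulrA.
    have [mu0 mu1] : 0 <= mu_part k /\ mu_part k <= 1.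
      split; first by apply: prodr_ge0 => i _; case: ifP.
      by apply: prodr_ile1 => i _; case: ifP; rewrite ?lexx ?ler01.
    have eta01 j : 0 <= (if (n j %| k)%N then c j ^+ (k`_p) else 1) <= 1.
      case: ifP => _; rewrite ?lexx ?ler01 //; have /andP[cj0 cj1] := c01 j.
      by rewrite exprn_ge0 ?exprn_ile1 // ltW.
    have [eta0 eta1] : 0 <= eta_part k (k`_p)%N /\ eta_part k (k`_p)%N <= 1.
      split; last by apply: prodr_ile1 => j _; exact: eta01.
      by apply: prodr_ge0 => j _; have /andP[] := eta01 j.
    apply: ler_piMr; first exact: exprn_ge0 (ltW r0).
    exact: mulr_ile1.
  move=> zA; apply: notD; rewrite -artin_mazur_zeta_logtheta.
  exact: algebraic_logtheta_D_finite.
Qed.
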